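(* Let $t\geq 4$ be an integer and let $f(x;t)=x^4-tx^3-x^2+tx+1\in\mathbf{Z}[x]$. Let $\alpha$ be a root of $f(x;t)$ and $K_t=\mathbf{Q}(\alpha)$. Then: (i) $f(x;t)$ is irreducible over $\mathbf{Q}$ and all its roots are real, so $K_t$ is a totally real quartic field whose unit group has rank $3$; (ii) $K_t$ is an exceptional number field; more precisely, both $\alpha$ and $\alpha^2$ are exceptional units of $K_t$; (iii) $K_t$ contains the real quadratic field $\mathbf{Q}(\sqrt{t^2-4})$; (iv) every real quadratic field $\mathbf{Q}(\sqrt{d})$ ($d>1$ square-free) is contained as a subfield in at least one of the fields $K_t$ (for some integer $t\geq 4$); (v) the splitting field of $f(x;t)$ over $\mathbf{Q}$ (the normal closure of $K_t$) has Galois group isomorphic to the dihedral group $D_4$ of order $8$.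
   Context: For a number field $F$ with ring of integers $\mathcal{O}_F$, a unit $\lambda\in\mathcal{O}_F^\times$ is called an exceptional unit if $1-\lambda$ is also a unit of $\mathcal{O}_F$. A number field is called exceptional if its ring of integers contains an exceptional unit. *)

(* Defs.v *)
From HB Require Import structures.
From mathcomp Require Import all_boot all_order all_algebra.
From mathcomp Require Import all_fingroup all_solvable all_field.

Set Implicit Arguments.
Unset Strict Implicit.
Unset Printing Implicit Defensive.

Import Order.TTheory GRing.Theory Num.Theory.

Local Open Scope ring_scope.

(* Number fields are finite extensions of rat, i.e. K : fieldExtType rat.
   Their complex embeddings are the ring morphisms into algC, since every such
   embedding has algebraic values. *)

Definition totally_real (K : fieldExtType rat) : Prop :=
  forall (sigma : {rmorphism K -> algC}) (x : K), sigma x \is Num.real.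

Definition algebraic_integer (K : fieldExtType rat) (x : K) : Prop :=
  integralOver (intr : int -> K) x.

Definition integer_unit (K : fieldExtType rat) (x : K) : Prop :=
  algebraic_integer x /\ exists2 y : K, algebraic_integer y & x * y = 1.

Definition exceptional_unit (K : fieldExtType rat) (x : K) : Prop :=
  integer_unit x /\ integer_unit (1 - x).

Definition exceptional_field (K : fieldExtType rat) : Prop :=
  exists x : K, exceptional_unit x.

Definition mul_independent (K : fieldType) (r : nat) (u : 'I_r -> K) : Prop :=
  forall n : 'I_r -> int, \prod_i u i ^ n i = 1 -> forall i, n i = 0.

(* The rank of the abelian group O_K^* : the maximal number of units which are
   linearly independent over Z (written multiplicatively). *)
Definition unit_rank (K : fieldExtType rat) (r : nat) : Prop :=
  (exists u : 'I_r -> K, (forall i, integer_unit (u i)) /\ mul_independent u)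
  /\ (forall u : 'I_r.+1 -> K,
        (forall i, integer_unit (u i)) -> ~ mul_independent u).

Definition contains_real_quadratic (K : fieldExtType rat) (d : int) : Prop :=
  exists (E : {subfield K}) (s : K),
    [/\ s ^+ 2 = d%:~R, (E : {vspace K}) = <<1; s>>%VS,
        \dim E = 2%N & totally_real (subvs_of E)].

Definition squarefree (d : nat) : Prop :=
  forall m : nat, (m ^ 2 %| d)%N -> m = 1%N.

Definition fpoly (t : int) : {poly int} :=
  'X^4 - t *: 'X^3 - 'X^2 + t *: 'X + 1.

Definition fpoly_in (R : nzRingType) (t : int) : {poly R} :=
  map_poly (intr : int -> R) (fpoly t).

Definition is_Kt (t : int) (K : fieldExtType rat) (alpha : K) : Prop :=
  root (fpoly_in K t) alpha /\ <<1; alpha>>%VS = {:K}%VS.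

(* normalField 1 E tests stability of E under the automorphisms of the ambient
   L only; this is normality of E over Q because L itself is normal. *)
Definition is_normal_closure (L : splittingFieldType rat) (F : {vspace L}) :
    Prop :=
  normalField 1 {:L}%VS /\
  forall E : {subfield L}, (F <= E)%VS -> normalField 1 E ->
    E = {:L}%VS :> {vspace L}.

(* Main.v *)
(* With y = x - 1/x one has f(x; t) = x^2 (y^2 - t y + 1), so the roots of f are
   a, -1/a, b, -1/b where a - 1/a and b - 1/b are the two roots e, 1/e of
   y^2 - t y + 1, and e generates Q(sqrt(t^2 - 4)).
   The identity x (x - 1) (x + 1) (t - x) = 1 at the roots makes a, a - 1 and
   a + 1 units; they are independent because x -> -1/x exchanges x - 1 and x + 1
   up to x, and because (x + 1) / (x - 1) is decreasing while x is increasing.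
   Any four units are dependent by a pigeonhole on their logarithms at the four
   real places, the norm of a nonzero algebraic integer being at least 1.
   Given d, a Pell solution x^2 - d y^2 = 1 yields t = 2 x with
   t^2 - 4 = d (2 y)^2.
   The Galois group preserves the partition {a, -1/a}, {b, -1/b}; it is the full
   group D_4 of this partition since neither 4 t^2 + 9 (the norm of e^2 + 4) nor
   (4 t^2 + 9) (t^2 - 4) is a square. *)
Require Import Defs.
From HB Require Import structures.
From mathcomp Require Import all_boot all_order all_algebra.
From mathcomp Require Import all_fingroup all_solvable all_field.
From mathcomp Require Import zify ring lra realalg.

Set Implicit Arguments.
Unset Strict Implicit.
Unset Printing Implicit Defensive.

Import Order.TTheory GRing.Theory Num.Theory.

Local Open Scope ring_scope.

(** * Irreducibility *)

Lemma fpoly_inE (R : nzRingType) (t : int) :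
  fpoly_in R t = 'X^4 - t%:~R *: 'X^3 - 'X^2 + t%:~R *: 'X + 1.
Proof.
by rewrite /fpoly_in /fpoly rmorphD rmorphD !rmorphB /= !map_polyZ /=
  !map_polyXn map_polyX rmorph1.
Qed.

Lemma root_fpoly_in (R : comNzRingType) (t : int) (x : R) :
  root (fpoly_in R t) x = (x ^+ 4 - t%:~R * x ^+ 3 - x ^+ 2 + t%:~R * x + 1 == 0).
Proof. by rewrite fpoly_inE rootE !hornerE. Qed.

Lemma size_fpoly_in (R : nzRingType) (t : int) : size (fpoly_in R t) = 5.
Proof.
rewrite fpoly_inE -!addrA size_polyDl size_polyXn //.
rewrite ltnS (leq_trans (size_polyD _ _)) // geq_max.
rewrite size_polyN (leq_trans (size_scale_leq _ _)) ?size_polyXn //=.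
rewrite (leq_trans (size_polyD _ _)) // geq_max size_polyN size_polyXn //=.
rewrite (leq_trans (size_polyD _ _)) // geq_max size_polyC.
by rewrite (leq_trans (size_scale_leq _ _)) ?size_polyX //= oner_eq0.
Qed.

Lemma monic_fpoly_in (R : nzRingType) (t : int) : fpoly_in R t \is monic.
Proof.
apply/monicP; rewrite /lead_coef size_fpoly_in fpoly_inE.
rewrite !(coefD, coefB, coefN, coefZ, coefXn, coefX, coef1) /=.
by rewrite !mulr0 !subr0 !addr0.
Qed.

Lemma fpoly_in_map (R S : nzRingType) (g : {rmorphism R -> S}) (t : int) :
  map_poly g (fpoly_in R t) = fpoly_in S t.
Proof.
by rewrite /fpoly_in -map_poly_comp; apply: eq_map_poly => z /=; rewrite rmorph_int.
Qed.

Lemma fpoly_in_int (t : int) : fpoly_in int t = fpoly t.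
Proof. by rewrite /fpoly_in map_poly_id // => x _; rewrite intz. Qed.

Lemma intz_mul_eq1 (a b : int) : 1 = a * b ->
  (a = 1 /\ b = 1) \/ (a = -1 /\ b = -1).
Proof.
move=> ab; have : a \is a GRing.unit by apply/unitrP; exists b; lia.
by rewrite unfold_in /= => /orP[]/eqP a1; move: ab; rewrite a1; [left|right]; lia.
Qed.

(** Compare coefficients. The leading and constant coefficients of both factors multiply to 1, so
    they are all 1 or -1. A linear factor would then have 1 or -1 as a root, but f takes the value 1
    at both points; the splitting into two quadratics is excluded by the three middle
    coefficients. *)
Lemma fpoly_factor_size1 (t : int) (p r : {poly int}) : 4 <= t ->
  fpoly t = p * r -> (size p <= size r)%N -> size p = 1%N.
Proof.
move=> t4 E le_pr.
have fE := esym (fpoly_in_int t).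
have p0 : p != 0.
  apply: contraTneq (monic_fpoly_in int t) => p0.
  by rewrite -fE E p0 mul0r monicE lead_coef0.
have r0 : r != 0.
  apply: contraTneq (monic_fpoly_in int t) => r0.
  by rewrite -fE E r0 mulr0 monicE lead_coef0.
have sz : (size p + size r = 6)%N.
  have := size_mul p0 r0; rewrite -E fE size_fpoly_in.
  have := size_poly_gt0 p; rewrite p0; move: (size p) (size r) => m n; lia.
have cE k : (fpoly t)`_k = \sum_(j < k.+1) p`_j * r`_(k - j) by rewrite E coefM.
have := cE 0%N; have := cE 1%N; have := cE 2%N; have := cE 3; have := cE 4.
have := cE 5.
rewrite fE fpoly_inE !big_ord_recr !big_ord0.
rewrite !(coefD, coefB, coefN, coefZ, coefXn, coefX, coef1) /= !intz.
have zp i : (size p <= i)%N -> p`_i = 0 by move=> ?; rewrite nth_default.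
have zr i : (size r <= i)%N -> r`_i = 0 by move=> ?; rewrite nth_default.
have p00 : (0 < size p)%N by rewrite size_poly_gt0.
have /or3P[/eqP//|/eqP sp|/eqP sp] : [|| size p == 1%N, size p == 2 | size p == 3].
  by move: (size p) (size r) p00 sz le_pr => m n; lia.
- have sr : size r = 4 by move: sz; rewrite sp => -[].
  rewrite !(zp 2) ?(zp 3) ?(zp 4) ?(zp 5) ?(zr 4) ?(zr 5) ?sp ?sr //.
  rewrite ?(mul0r, mulr0, addr0, add0r, subr0, mulr1, oppr0).
  move: (p`_0) (p`_1) (r`_0) (r`_1) (r`_2) (r`_3) => a b c d e f.
  move=> _ H4 H3 H2 H1 H0.
  by case: (intz_mul_eq1 H4) => -[? ?];
    case: (intz_mul_eq1 H0) => -[? ?]; subst; lia.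
- have sr : size r = 3 by move: sz; rewrite sp => -[].
  rewrite !(zp 3) ?(zp 4) ?(zp 5) ?(zr 3) ?(zr 4) ?(zr 5) ?sp ?sr //.
  rewrite ?(mul0r, mulr0, addr0, add0r, subr0, mulr1, oppr0).
  move: (p`_0) (p`_1) (p`_2) (r`_0) (r`_1) (r`_2) => a b c d e f.
  move=> _ H4 H3 H2 H1 H0.
  case: (intz_mul_eq1 H4) => -[? ?];
    case: (intz_mul_eq1 H0) => -[? ?]; subst; try lia.
  (* The coefficient of x^2 forces b e = 1, hence b + e is 2 or -2, whereas the coefficient of x^3
     makes it t or -t. *)
  + have /intz_mul_eq1 : 1 = b * e by lia.
    by lia.
  + have /intz_mul_eq1 : 1 = b * e by lia.
    by lia.
Qed.

Lemma irreducible_fpoly_in (t : int) : 4 <= t -> irreducible_poly (fpoly_in rat t).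
Proof.
move=> t4; apply/irreducible_rat_int.
have sf : size (fpoly t) = 5.
  by rewrite -(size_fpoly_in rat t) /fpoly_in size_rat_int_poly.
have sQ q : q %| fpoly_in rat t -> size q != 1%N -> size q = 5.
  (* Gauss's lemma: up to a rational scalar the divisor is integral, with an integral cofactor. *)
  case/dvdpP_rat_int => p [c c0 ->] [r E].
  rewrite size_scale // size_rat_int_poly => sp.
  case: (leqP (size p) (size r)) => [le_pr|/ltnW le_rp].
    by rewrite (fpoly_factor_size1 t4 E le_pr) in sp.
  rewrite mulrC in E.
  have sr := fpoly_factor_size1 t4 E le_rp.
  have /size_poly1P[d d0 rE] : size r == 1%N by rewrite sr.
  by rewrite -sf E rE mul_polyC size_scale.
apply/irreducible_rat_int; split=> [|q q1 qf]; first by rewrite size_fpoly_in.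
by rewrite -dvdp_size_eqp // (sQ _ qf q1) size_fpoly_in.
Qed.

(** * Real roots and exceptional units *)

Lemma fpoly_factorization (R : comNzRingType) (t : int) (x : R) :
  root (fpoly_in R t) x -> x * (x - 1) * (x + 1) * (t%:~R - x) = 1.
Proof.
rewrite root_fpoly_in => /eqP fx.
by apply/eqP; rewrite -subr_eq0 -oppr_eq0 -[X in _ == X]fx; apply/eqP; ring.
Qed.

Lemma root_fpoly_neq0 (F : fieldType) (t : int) (x : F) :
  root (fpoly_in F t) x -> x != 0.
Proof.
move/fpoly_factorization=> E; apply/eqP => x0.
by move: E; rewrite x0 !mul0r => /eqP; rewrite eq_sym oner_eq0.
Qed.

Lemma root_fpolyE (F : fieldType) (t : int) (x : F) : x != 0 ->
  root (fpoly_in F t) x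
  = ((x - x^-1) ^+ 2 - t%:~R * (x - x^-1) + 1 == 0).
Proof.
move=> x0; rewrite root_fpoly_in.
have -> : x ^+ 4 - t%:~R * x ^+ 3 - x ^+ 2 + t%:~R * x + 1 =
   x ^+ 2 * ((x - x^-1) ^+ 2 - t%:~R * (x - x^-1) + 1) by field.
by rewrite mulf_eq0 sqrf_eq0 (negbTE x0).
Qed.

Lemma root_fpoly_invN (F : fieldType) (t : int) (x : F) :
  root (fpoly_in F t) x -> root (fpoly_in F t) (- x^-1).
Proof.
move=> fx; have x0 := root_fpoly_neq0 fx; move: fx.
rewrite !root_fpolyE ?oppr_eq0 ?invr_eq0 //.
by rewrite invrN invrK opprK [- x^-1 + x]addrC.
Qed.

Lemma sqr_ge0_real (x : algC) : 0 <= x ^+ 2 -> x \is Num.real.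
Proof.
move=> x2; have : x ^+ 2 == sqrtC (x ^+ 2) ^+ 2 by rewrite sqrtCK.
have rs : sqrtC (x ^+ 2) \is Num.real by rewrite ger0_real ?sqrtC_ge0.
by rewrite eqf_sqr => /orP[]/eqP ->; rewrite ?rpredN.
Qed.

Lemma monic_quadratic_real (b c x : algC) : b \is Num.real ->
  x ^+ 2 - b * x + c = 0 -> 0 <= b ^+ 2 - 4 * c -> x \is Num.real.
Proof.
move=> br xE disc.
have d : 2 * x - b \is Num.real.
  apply: sqr_ge0_real.
  have -> : (2 * x - b) ^+ 2 = 4 * (x ^+ 2 - b * x + c) + (b ^+ 2 - 4 * c) by ring.
  by rewrite xE mulr0 add0r.
have -> : x = (2 * x - b + b) / 2 by field.
by apply: rpred_div; [apply: rpredD | exact: realn].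
Qed.

(** Two quadratic equations in succession: e = z - 1/z solves y^2 - t y + 1 = 0, of discriminant t^2
    - 4, and then z solves x^2 - e x - 1 = 0, of discriminant e^2 + 4 with e real. *)
Lemma root_fpoly_real (t : int) (z : algC) : 4 <= t ->
  root (fpoly_in algC t) z -> z \is Num.real.
Proof.
move=> t4 fz; have z0 := root_fpoly_neq0 fz.
move: fz; rewrite root_fpolyE //; set e := z - z^-1 => /eqP eE.
have er : e \is Num.real.
  apply: (monic_quadratic_real _ eE); first by rewrite realz.
  have -> : t%:~R ^+ 2 - 4 * 1 = (t ^+ 2 - 4)%:~R :> algC.
    by rewrite rmorphB rmorphXn /= mulr1.
  rewrite ler0z.
  by move: t4; nia.
apply: (@monic_quadratic_real e (-1)) => //; first by rewrite /e; field.
by rewrite mulrN1 opprK addr_ge0 // real_exprn_even_ge0.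
Qed.

(** The minimal polynomial has coefficients in F, divides p and is not constant, so irreducibility
    of p leaves no other choice. *)
Lemma minPoly1_irreducible (F : fieldType) (L : fieldExtType F) (p : {poly F})
    (a : L) : irreducible_poly p -> root (map_poly (in_alg L) p) a ->
  minPoly 1 a %= map_poly (in_alg L) p.
Proof.
move=> [sp irr_p] pa0.
have /polyOver1P[q qE] := minPolyOver 1 a.
have : minPoly 1 a %| map_poly (in_alg L) p.
  by apply: minPoly_dvdp => //; apply: alg_polyOver.
rewrite qE dvdp_map => q_p; rewrite eqp_map; apply: irr_p => //.
by rewrite -(size_map_poly (in_alg L)) -qE size_minPoly.
Qed.

Lemma minPoly_fpoly (L : fieldExtType rat) (t : int) (a : L) : 4 <= t ->
  root (fpoly_in L t) a -> minPoly 1 a = fpoly_in L t.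
Proof.
move=> t4 fa; apply/eqP; rewrite -eqp_monic ?monic_minPoly ?monic_fpoly_in //.
rewrite -(fpoly_in_map (in_alg L)); apply: minPoly1_irreducible.
  exact: irreducible_fpoly_in.
by rewrite fpoly_in_map.
Qed.

Lemma dim_Kt (t : int) (K : fieldExtType rat) (alpha : K) : 4 <= t ->
  is_Kt t alpha -> \dim {:K}%VS = 4%N.
Proof.
move=> t4 [fa <-]; rewrite dim_Fadjoin dimv1 muln1.
by apply/eqP; rewrite -eqSS -size_minPoly (minPoly_fpoly t4 fa) size_fpoly_in.
Qed.

Lemma rmorph_in_alg_rat (K : fieldExtType rat) (F : fieldType)
  (sigma : {rmorphism K -> F}) (q : rat) : sigma q%:A = ratr q.
Proof. exact: (fmorph_eq_rat (sigma \o in_alg K)). Qed.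

Lemma rmorph_horner_rat (K : fieldExtType rat) (F : fieldType)
  (sigma : {rmorphism K -> F}) (p : {poly rat}) (a : K) :
  sigma (map_poly (in_alg K) p).[a] = (map_poly ratr p).[sigma a].
Proof.
rewrite -horner_map -map_poly_comp; congr _.[_]; apply: eq_map_poly => q /=.
exact: rmorph_in_alg_rat.
Qed.

Lemma horner_rat_real (p : {poly rat}) (z : algC) :
  z \is Num.real -> (map_poly ratr p).[z] \is Num.real.
Proof.
move=> zr; apply: rpred_horner => //; apply/polyOverP => i.
by rewrite coef_map; apply: Creal_Crat; apply: Crat_rat.
Qed.

Lemma totally_real_Kt (t : int) (K : fieldExtType rat) (alpha : K) : 4 <= t ->
  is_Kt t alpha -> totally_real K.
Proof.
move=> t4 [fa Ka] sigma x.
have /Fadjoin1_polyP[p ->] : x \in <<1; alpha>>%VS by rewrite Ka memvf.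
rewrite rmorph_horner_rat; apply: horner_rat_real.
apply: (root_fpoly_real t4); rewrite -(fpoly_in_map sigma).
by rewrite fmorph_root.
Qed.

(** * Units of the ring of integers *)

Section IntegerUnits.

Variable K : fieldExtType rat.
Implicit Types x y : K.

Lemma algebraic_integer_int (m : int) : algebraic_integer (m%:~R : K).
Proof. exact: integral_id. Qed.

Lemma algebraic_integerB x y : algebraic_integer x -> algebraic_integer y ->
  algebraic_integer (x - y).
Proof. exact: integral_sub. Qed.

Lemma algebraic_integerM x y : algebraic_integer x -> algebraic_integer y ->
  algebraic_integer (x * y).
Proof. exact: integral_mul. Qed.

Lemma algebraic_integerN x : algebraic_integer x -> algebraic_integer (- x).
Proof. exact: integral_opp. Qed.

Lemma algebraic_integerD x y : algebraic_integer x -> algebraic_integer y ->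
  algebraic_integer (x + y).
Proof. exact: integral_add. Qed.

Lemma integer_unit1 : integer_unit (1 : K).
Proof.
have I1 := algebraic_integer_int 1.
by split=> //; exists 1; rewrite ?mulr1.
Qed.

Lemma integer_unitM x y : integer_unit x -> integer_unit y ->
  integer_unit (x * y).
Proof.
move=> [Ix [x' Ix' xx']] [Iy [y' Iy' yy']].
split; first exact: algebraic_integerM.
by exists (x' * y'); [exact: algebraic_integerM | rewrite mulrACA xx' yy' mulr1].
Qed.

Lemma integer_unit_neq0 x : integer_unit x -> x != 0.
Proof.
move=> [_ [y _ xy]]; apply/eqP => x0.
by move: xy; rewrite x0 mul0r => /eqP; rewrite eq_sym oner_eq0.
Qed.

Lemma integer_unitV x : integer_unit x -> integer_unit x^-1.
Proof.
move=> Ux; have x0 := integer_unit_neq0 Ux; case: Ux => [Ix [y Iy xy]].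
have <- : y = x^-1 by apply: (mulfI x0); rewrite xy mulfV.
by split=> //; exists x; rewrite // mulrC.
Qed.

Lemma integer_unitX x n : integer_unit x -> integer_unit (x ^+ n).
Proof.
move=> Ux; elim: n => [|n IHn]; first exact: integer_unit1.
by rewrite exprS; apply: integer_unitM.
Qed.

Lemma integer_unit_prod (I : Type) (r : seq I) (P : pred I) (u : I -> K) :
  (forall i, P i -> integer_unit (u i)) -> integer_unit (\prod_(i <- r | P i) u i).
Proof.
by move=> Uu; apply: big_ind => //; [exact: integer_unit1 | exact: integer_unitM].
Qed.

Lemma root_fpoly_units (t : int) (x : K) : root (fpoly_in K t) x ->
  [/\ integer_unit x, integer_unit (x - 1) & integer_unit (x + 1)].
Proof.
move=> fx; have Ix : algebraic_integer x.
  by exists (fpoly t); rewrite // -fpoly_in_int monic_fpoly_in.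
have I1 := algebraic_integer_int 1; have It := algebraic_integer_int t.
have E := fpoly_factorization fx.
have I2 : algebraic_integer (x - 1) by apply: algebraic_integerB.
have I3 : algebraic_integer (x + 1) by apply: algebraic_integerD.
have I4 : algebraic_integer (t%:~R - x) by apply: algebraic_integerB.
split; split=> //.
- exists ((x - 1) * (x + 1) * (t%:~R - x)); last by rewrite !mulrA.
  by do 2?[apply: algebraic_integerM => //].
- exists (x * (x + 1) * (t%:~R - x)); last by rewrite -[RHS]E; ring.
  by do 2?[apply: algebraic_integerM => //].
- exists (x * (x - 1) * (t%:~R - x)); last by rewrite -[RHS]E; ring.
  by do 2?[apply: algebraic_integerM => //].
Qed.

Lemma integer_unitN x : integer_unit x -> integer_unit (- x).
Proof.
move=> [Ix [y Iy xy]]; split; first exact: algebraic_integerN.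
by exists (- y); [exact: algebraic_integerN | rewrite mulrNN].
Qed.

Lemma exceptional_unit_root (t : int) x : root (fpoly_in K t) x ->
  exceptional_unit x /\ exceptional_unit (x ^+ 2).
Proof.
move=> fx; have [U1 U2 U3] := root_fpoly_units fx.
split; split=> //.
- by rewrite -opprB; apply: integer_unitN.
- exact: integer_unitX.
- have -> : 1 - x ^+ 2 = - ((x - 1) * (x + 1)) by ring.
  by apply: integer_unitN; apply: integer_unitM.
Qed.

End IntegerUnits.

(** Since s is irrational and a root of X^2 - d, its degree is exactly 2. An embedding of Q(s) sends
    s to a square root of d >= 0, which is real, and everything else is a rational polynomial in
    s. *)
Lemma contains_real_quadratic_sqrt (K : fieldExtType rat) (d : int) (s : K) :
  0 <= d -> (forall q : rat, q ^+ 2 != d%:~R) -> s ^+ 2 = d%:~R ->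
  contains_real_quadratic K d.
Proof.
move=> d0 dns sE; exists <<1; s>>%AS, s; split=> //.
  have s1 : s \notin 1%VS.
    apply/negP => /vlineP[q sq]; have /eqP[] := dns q.
    apply: (fmorph_inj (in_alg K)); rewrite rmorphXn /= -sq sE.
    exact: esym (rmorph_int (in_alg K) d).
  have ss : root ('X^2 - (d%:~R)%:P) s.
    by rewrite rootE !hornerE sE subrr.
  have : (size (minPoly 1 s) <= 3)%N.
    rewrite -(size_XnsubC (d%:~R : K) (isT : (0 < 2)%N)) dvdp_leq //.
      by rewrite -size_poly_eq0 size_XnsubC.
    apply: minPoly_dvdp => //; rewrite rpredB ?rpredX ?polyOverX ?polyOverC //.
    by rewrite rpred_int.
  rewrite size_minPoly ltnS => le2; rewrite dim_Fadjoin dimv1 muln1.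
  by apply/eqP; rewrite eqn_leq le2 ltn_neqAle eq_sym adjoin_deg_eq1 s1 /adjoin_degree.
move=> sigma x; have /Fadjoin1_polyP[p xE] := subvsP x.
have Es := memv_adjoin 1 s.
(* The embedding [sigma] is defined on the subfield only, so the polynomial expression is moved from
   K into that subfield. *)
have -> : x = (map_poly (in_alg _) p).[vsproj <<1; s>> s].
  apply: val_inj; rewrite [val x]xE -horner_map /= vsprojK //.
  by rewrite -map_poly_comp; congr _.[_]; apply: eq_map_poly => q /=; rewrite algid1.
rewrite rmorph_horner_rat; apply/horner_rat_real/sqr_ge0_real.
rewrite -rmorphXn; have -> : (vsproj <<1; s>>%VS s) ^+ 2 = d%:~R.
  by apply: val_inj; rewrite rmorphXn /= vsprojK // sE rmorph_int.
by rewrite rmorph_int ler0z.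
Qed.

(** * Real embeddings and norms *)

(** The map sends q(alpha) to q(a). It is well defined because p is, up to a scalar, the minimal
    polynomial of alpha, so every q that kills alpha is a multiple of p and kills a as well. *)
Lemma exists_embedding (K : fieldExtType rat) (R : numFieldType)
    (p : {poly rat}) (alpha : K) (a : R) :
  irreducible_poly p -> root (map_poly (in_alg K) p) alpha ->
  <<1; alpha>>%VS = {:K}%VS -> root (map_poly ratr p) a ->
  exists sigma : {rmorphism K -> R}, sigma alpha = a.
Proof.
move=> irr_p p_alpha K_alpha p_a.
have ex_q x : exists q : {poly rat}, x == (map_poly (in_alg K) q).[alpha].
  have /Fadjoin1_polyP[q ->] : x \in <<1; alpha>>%VS by rewrite K_alpha memvf.
  by exists q.
have q0 q : (map_poly (in_alg K) q).[alpha] = 0 -> (map_poly ratr q).[a] = 0.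
  move=> /eqP qalpha; apply/rootP.
  have := minPoly_dvdp (alg_polyOver 1 q) qalpha.
  rewrite (eqp_dvdl _ (minPoly1_irreducible irr_p p_alpha)) dvdp_map => pq.
  by move: p_a; rewrite -!dvdp_XsubCl => /dvdp_trans; apply; rewrite dvdp_map.
pose phi x := (map_poly ratr (xchoose (ex_q x))).[a].
(* The value does not depend on the polynomial picked by [xchoose]; additivity and multiplicativity
   follow from this. *)
have phiE q : phi (map_poly (in_alg K) q).[alpha] = (map_poly ratr q).[a].
  apply/eqP; rewrite -subr_eq0 -hornerN -hornerD -rmorphB; apply/eqP/q0.
  by rewrite rmorphB hornerD hornerN -(eqP (xchooseP (ex_q _))) subrr.
have phiB : zmod_morphism phi.
  move=> x y; rewrite (eqP (xchooseP (ex_q x))) (eqP (xchooseP (ex_q y))).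
  by rewrite -hornerN -hornerD -rmorphB !phiE rmorphB hornerD hornerN.
have phiM : monoid_morphism phi.
  split=> [|x y].
    have -> : 1 = (map_poly (in_alg K) 1).[alpha] by rewrite rmorph1 hornerC.
    by rewrite phiE rmorph1 hornerC.
  rewrite (eqP (xchooseP (ex_q x))) (eqP (xchooseP (ex_q y))).
  by rewrite -hornerM -rmorphM !phiE rmorphM hornerM.
pose phiB' := GRing.isZmodMorphism.Build K R phi phiB.
pose phiM' := GRing.isMonoidMorphism.Build K R phi phiM.
pose sigma : {rmorphism K -> R} := HB.pack phi phiB' phiM'.
exists sigma; rewrite /= -[alpha in LHS]hornerX -(map_polyX (in_alg K)) phiE.
by rewrite map_polyX hornerX.
Qed.

(** The equation has integer coefficients and a rational root, so it descends from R to [rat] and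
    lifts to [algC], where rational algebraic integers are known to be integers. *)
Lemma integral_rat_int (R : numFieldType) (q : rat) :
  integralOver (intr : int -> R) (ratr q) ->
  exists m : int, q = m%:~R.
Proof.
case=> p mon_p.
have -> : map_poly intr p = map_poly ratr (map_poly intr p) :> {poly R}.
  by rewrite -map_poly_comp; apply: eq_map_poly => y; rewrite /= rmorph_int.
rewrite fmorph_root -(fmorph_root (ratr : {rmorphism rat -> algC})).
rewrite -map_poly_comp (eq_map_poly (g := intr)) => [pq|y]; last first.
  by rewrite /= rmorph_int.
have Aq : (ratr q : algC) \in Aint.
  apply: root_monic_Aint pq _ _; first exact: monic_map.
  by apply/polyOverP => i; rewrite coef_map /= rpred_int.
have /intrP[m qm] := Cint_rat_Aint (Crat_rat q) Aq.
exists m; apply: (fmorph_inj (ratr : {rmorphism rat -> algC})).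
by rewrite /= qm rmorph_int.
Qed.

Section Norm.

Variables (K : fieldExtType rat) (R : realFieldType) (n : nat).
Variables (sigma : 'I_n -> {rmorphism K -> R}) (alpha : K).
Hypotheses (K_alpha : <<1; alpha>>%VS = {:K}%VS) (dimK : \dim {:K} = n).
Hypothesis sigma_inj : injective (fun i => sigma i alpha).

(* The norm is the determinant of multiplication by x in the power basis;
   the Vandermonde matrix of the conjugates of alpha diagonalises it. *)
Lemma norm_rat (x : K) : exists q : rat, \prod_i sigma i x = ratr q.
Proof.
have /fin_all_exists[q qE] (i : 'I_n) : exists q : {poly rat},
    map_poly (in_alg K) q = Fadjoin_poly 1 alpha (x * alpha ^+ i).
  have /polyOver1P[p ->] := Fadjoin_polyOver 1 alpha (x * alpha ^+ i).
  by exists p.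
have deg : adjoin_degree 1 alpha = n.
  by rewrite adjoin_degreeE K_alpha dimK dimv1 divn1.
have sz i : (size (q i) <= n)%N.
  by rewrite -(size_map_poly (in_alg K)) qE -[X in (_ <= X)%N]deg size_Fadjoin_poly.
pose M : 'M[rat]_n := \matrix_(i, j) (q i)`_j.
pose a : 'rV[R]_n := \row_k sigma k alpha.
pose D : 'rV[R]_n := \row_k sigma k x.
have MV : map_mx ratr M *m Vandermonde n a = Vandermonde n a *m diag_mx D.
  apply/matrixP => i k; rewrite mul_mx_diag !mxE.
  have := rmorph_horner_rat (sigma k) (q i) alpha.
  rewrite qE Fadjoin_poly_eq ?K_alpha ?memvf // rmorphM rmorphXn mulrC /= => ->.
  rewrite (horner_coef_wide _ (n := n)) ?size_map_poly //.
  by apply: eq_bigr => j _; rewrite !mxE coef_map.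
exists (\det M); have := congr1 determinant MV.
rewrite !det_mulmx det_map_mx det_diag mulrC => /mulfI ->.
  by apply: eq_bigr => i _; rewrite mxE.
rewrite det_Vandermonde; apply/prodf_neq0 => i _; apply/prodf_neq0 => j lt_ij.
rewrite subr_eq0 !mxE; apply: contraTneq lt_ij => /sigma_inj ->.
by rewrite ltnn.
Qed.

(** The product of the conjugates is rational and integral, hence a nonzero integer. *)
Lemma norm_ge1 (x : K) : algebraic_integer x -> x != 0 ->
  1 <= `|\prod_i sigma i x|.
Proof.
move=> Ix x0; have [q qE] := norm_rat x.
have [m mE] : exists m : int, q = m%:~R.
  apply: (@integral_rat_int R); rewrite -qE; apply: big_ind.
  - exact: (integral_id _ 1).
  - by move=> y z; apply: integral_mul.
  - move=> i _; have [p mon_p px] := Ix; exists p => //.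
    move: px; rewrite -(fmorph_root (sigma i)) -map_poly_comp.
    by under eq_map_poly do rewrite /= rmorph_int.
have : \prod_i sigma i x != 0 by apply/prodf_neq0 => i _; rewrite fmorph_eq0.
rewrite qE mE rmorph_int intr_eq0 -intr_norm (ler_int _ 1) => m0.
by rewrite -gtz0_ge1 normr_gt0.
Qed.

End Norm.

(** * Upper bound for the unit rank *)

Section LogCells.

Variables (R : archiRealFieldType) (S : nat).

(** A rounded base 2 logarithm, shifted by S: the factor 2^S brings the range from 2^-S to 2^S above
    1, so that natural number levels from 0 to 2S suffice. *)
Definition log2_level (x : R) : nat := trunc_log 2 (Num.truncn (2 ^+ S * x)).

Lemma log2_level_le (x : R) : x <= 2 ^+ S -> (log2_level x <= S + S)%N.
Proof.
move=> xS; rewrite -(trunc_expnK (S + S) (isT : (1 < 2)%N)); apply: leq_trunc_log.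
rewrite -[X in (_ <= X)%N](@natrK R); apply: le_truncn.
by rewrite natrX exprD ler_pM2l // exprn_gt0.
Qed.

(** If k is the common level, then 2^S x < 2^(k+1) <= 2 (2^S y). The bound on y makes the truncation
    positive; at 0, [trunc_log] returns the default 0, which gives no lower bound. *)
Lemma log2_level_eq (x y : R) : 1 <= 2 ^+ S * y -> log2_level x = log2_level y ->
  x < 2 * y.
Proof.
move=> y1 xy; have S0 : (0 : R) < 2 ^+ S by rewrite exprn_gt0.
rewrite -(ltr_pM2l S0) mulrCA; apply: lt_le_trans (truncnS_gt _) _.
have := trunc_log_ltn (Num.truncn (2 ^+ S * x)) (isT : (1 < 2)%N).
rewrite -[trunc_log 2 _]/(log2_level x) xy => xlt.
apply: (le_trans (y := (2 ^ (log2_level y).+1)%:R)); first by rewrite ler_nat.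
rewrite natrX exprS ler_pM2l // -natrX -truncn_ge_nat; last exact: le_trans y1.
by apply: trunc_logP => //; rewrite truncn_gt0.
Qed.

End LogCells.

Lemma truncn_eq_dist (R : archiRealFieldType) (x y : R) : 0 <= x -> 0 <= y ->
  Num.truncn x = Num.truncn y -> `|x - y| < 1.
Proof.
move=> x0 y0 xy; have /andP[x1 x2] := truncn_itv x0.
have /andP[y1 y2] := truncn_itv y0.
rewrite xy in x1 x2; rewrite -natr1 in x2 y2.
by rewrite ltr_norml; apply/andP; split; lra.
Qed.

Lemma prod_powers_le (R : realFieldType) (m C N : nat) (w : 'I_m -> R)
    (e : 'I_m -> 'I_N) : (forall j, 0 <= w j <= 2 ^+ C) ->
  \prod_j w j ^+ e j <= 2 ^+ (C * N * m).
Proof.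
move=> wC; have -> : 2 ^+ (C * N * m) = \prod_(j < m) (2 ^+ (C * N) : R).
  by rewrite prodr_const card_ord -exprM.
apply: ler_prod => j _; have /andP[w0 w2] := wC j.
rewrite exprn_ge0 //=; apply: le_trans (_ : 2 ^+ (C * e j) <= _).
  by rewrite exprM lerXn2r // nnegrE exprn_ge0.
by rewrite ler_eXn2l ?ltr1n // leq_mul2l ltnW ?orbT.
Qed.

Section UnitRankBound.

Variables (K : fieldExtType rat) (R : archiRealFieldType) (n : nat).
Variable sigma : 'I_n.+1 -> {rmorphism K -> R}.
Hypothesis norm_ge1 : forall x : K, algebraic_integer x -> x != 0 ->
  1 <= `|\prod_i sigma i x|.

(** The norms of x and of its inverse are both at least 1 and multiply to 1. *)
Lemma norm_unit (x : K) : integer_unit x -> `|\prod_i sigma i x| = 1.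
Proof.
move=> Ux; have x0 := integer_unit_neq0 Ux; have [Ix [y Iy xy]] := Ux.
have y0 : y != 0 by apply: contra_eq_neq xy => ->; rewrite mulr0 eq_sym oner_eq0.
have := norm_ge1 Ix x0; have := norm_ge1 Iy y0.
have : `|\prod_i sigma i x| * `|\prod_i sigma i y| = 1.
  rewrite -normrM -big_split /=; under eq_bigr do rewrite -rmorphM xy rmorph1.
  by rewrite big1 ?normr1.
set a := `|_|; set b := `|_| => ab b1 a1.
by apply/le_anti; rewrite a1 andbT -ab ler_peMr // (le_trans _ a1).
Qed.

(** Otherwise x - y would be a nonzero algebraic integer of norm less than 1. *)
Lemma units_close_eq (x y : K) : algebraic_integer x -> algebraic_integer y ->
  (forall i, `|sigma i x - sigma i y| < 1) -> x = y.
Proof.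
move=> Ix Iy xy; apply/eqP; rewrite -subr_eq0; apply/negPn/negP => nz.
have := norm_ge1 (algebraic_integerB Ix Iy) nz.
rewrite leNgt normr_prod => /negP[].
apply: lt_le_trans (_ : \prod_(i < n.+1) 1 <= _); last by rewrite big1.
apply: ltr_prod => [|i _]; first by apply/hasP; exists ord0; rewrite ?mem_index_enum.
by rewrite normr_ge0 rmorphB xy.
Qed.

(** Place 0 carries no assumption: as the norm is 1, the value there is the inverse of the product
    of the n others, each inverse being below 2. *)
Lemma unit_embedding_bound (x : K) : integer_unit x ->
  (forall i : 'I_n, 2^-1 < `|sigma (lift ord0 i) x| < 2) ->
  forall i, `|sigma i x| < 2 ^+ n.+1.
Proof.
move=> Ux xb i; have := norm_unit Ux.
have x0 := integer_unit_neq0 Ux.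
case: (unliftP ord0 i) => [j ->|->] _ ; last first.
  have := norm_unit Ux; rewrite normr_prod big_ord_recl => E.
  have P0 : 0 < \prod_(i < n) `|sigma (lift ord0 i) x|.
    by apply: prodr_gt0 => k _; rewrite normr_gt0 fmorph_eq0.
  have -> : `|sigma ord0 x| = \prod_(i < n) `|sigma (lift ord0 i) x|^-1.
    rewrite prodfV; apply: (mulIf (lt0r_neq0 P0)).
    by rewrite E mulVf // lt0r_neq0.
  apply: le_lt_trans (_ : 2 ^+ n < _); last by rewrite ltr_eXn2l ?ltr1n.
  have -> : 2 ^+ n = \prod_(i < n) (2 : R) by rewrite prodr_const card_ord.
  apply: ler_prod => k _; rewrite invr_ge0 normr_ge0 /=.
  have /andP[lb _] := xb k; rewrite -[leRHS]invrK lef_pV2 ?ltW // posrE ?invr_gt0 //.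
  by rewrite normr_gt0 fmorph_eq0.
have /andP[_ ub] := xb j; apply: lt_le_trans ub _.
by rewrite exprS ler_peMr // exprn_ege1 // ler1n.
Qed.

(* Pigeonhole in two scales: among N^(n+1) exponent vectors, so many share
   the same rounded logarithms at n places that, after division by a fixed
   representative, two of the resulting bounded units are within distance 1
   at every place, hence equal. *)
Lemma units_dependent (u : 'I_n.+1 -> K) : (forall j, integer_unit (u j)) ->
  ~ mul_independent u.
Proof.
move=> Uu indep; have u0 j := integer_unit_neq0 (Uu j).
pose a i j := `|sigma i (u j)|.
have a0 i j : 0 < a i j by rewrite normr_gt0 fmorph_eq0 u0.
(* C is chosen so that 2^C bounds every |sigma_i(u_j)| and its inverse. *)
pose b (p : 'I_n.+1 * 'I_n.+1) :=
  (Num.truncn (a p.1 p.2) + Num.truncn (a p.1 p.2)^-1).+1.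
pose C := \max_p b p.
have leC m i j : (m <= Num.truncn (a i j) + Num.truncn (a i j)^-1)%N ->
    m.+1%:R <= 2 ^+ C :> R.
  move=> le_m; rewrite -natrX ler_nat.
  apply: leq_trans (ltnW (ltn_expl C (isT : (1 < 2)%N))).
  by apply: leq_trans (leq_bigmax (i, j)); rewrite ltnS.
have aC i j : a i j <= 2 ^+ C.
  by apply: le_trans (ltW (truncnS_gt _)) (leC _ i j (leq_addr _ _)).
have aVC i j : (a i j)^-1 <= 2 ^+ C.
  by apply: le_trans (ltW (truncnS_gt _)) (leC _ i j (leq_addl _ _)).
(* All |sigma_i(U e)| lie between 2^-S and 2^S, which makes 2S + 1 <= A N levels at each of n
   places, while M bounds the quotients of units on the same levels. Hence at most (A N)^n (2M +
   1)^(n+1) cells occur, and N exceeds A^n (2M + 1)^(n+1) by one so that this is less than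
   N^(n+1). *)
pose M := (2 ^ n.+1)%N; pose A := (2 * (C * n.+1)).+1.
pose N := (A ^ n * (2 * M).+1 ^ n.+1).+1; pose S := (C * N * n.+1)%N.
pose U (e : {ffun 'I_n.+1 -> 'I_N}) := \prod_j u j ^+ e j.
have UU e : integer_unit (U e).
  by apply: integer_unit_prod => j _; apply: integer_unitX.
have absU i e : `|sigma i (U e)| = \prod_j a i j ^+ e j.
  rewrite rmorph_prod normr_prod; apply: eq_bigr => j _.
  by rewrite rmorphXn normrX.
have U_le i e : `|sigma i (U e)| <= 2 ^+ S.
  by rewrite absU; apply: prod_powers_le => j; rewrite aC ltW.
have U_ge i e : 1 <= 2 ^+ S * `|sigma i (U e)|.
  have p0 : 0 < `|sigma i (U e)| by rewrite normr_gt0 fmorph_eq0 integer_unit_neq0.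
  rewrite -ler_pdivrMr // mul1r absU -prodfV.
  under eq_bigr do rewrite -exprVn.
  by apply: prod_powers_le => j; rewrite aVC invr_ge0 ltW.
pose c1 e : {ffun 'I_n -> 'I_(S + S).+1} :=
  [ffun i => inord (log2_level S `|sigma (lift ord0 i) (U e)|)].
have c1_lt e e' i : c1 e = c1 e' ->
    `|sigma (lift ord0 i) (U e)| < 2 * `|sigma (lift ord0 i) (U e')|.
  move=> /ffunP/(_ i); rewrite !ffunE => /(congr1 val).
  by rewrite /= !inordK ?ltnS ?log2_level_le // => /log2_level_eq; apply.
have quot_bound e e' : c1 e = c1 e' -> forall i, `|sigma i (U e / U e')| < 2 ^+ n.+1.
  move=> ee'; apply: unit_embedding_bound.
    by apply: integer_unitM => //; apply: integer_unitV.
  move=> i; have p0 : 0 < `|sigma (lift ord0 i) (U e')|.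
    by rewrite normr_gt0 fmorph_eq0 integer_unit_neq0.
  rewrite fmorph_div normf_div ltr_pdivlMr // ltr_pdivrMr // c1_lt // andbT.
  by rewrite mulrC ltr_pdivrMr // [_ * 2]mulrC c1_lt.
(* The representative depends on [c1 e] alone, so it is shared by all vectors of one class; the
   default 1 never occurs, as e itself qualifies. *)
pose g e := if [pick e' | c1 e' == c1 e] is Some e' then U e / U e' else 1.
(* Adding M makes the value nonnegative, so truncation separates points at distance 1 or more. *)
pose c2 e : {ffun 'I_n.+1 -> 'I_(2 * M).+1} :=
  [ffun i => inord (Num.truncn (sigma i (g e) + M%:R))].
pose c e := (c1 e, c2 e).
have /injectivePn[e [e' ne_ee' [ec1 ec2]]] : ~~ injectiveb c.
  apply/negP => /injectiveP/leq_card; apply/negP.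
  rewrite card_prod !card_ffun !card_ord -ltnNge.
  have AN : ((S + S).+1 <= A * N)%N by rewrite /S /A; nia.
  apply: leq_ltn_trans (_ : (A * N) ^ n * (2 * M).+1 ^ n.+1 < _)%N.
    have leX x y m : (x <= y -> x ^ m <= y ^ m)%N by case: m => // m; rewrite leq_exp2r.
    by rewrite leq_mul2r leX ?orbT.
  rewrite expnMn mulnAC [in ltnRHS]expnS ltn_pmul2r //.
  by rewrite expn_gt0.
have [r [re ge ge']] : exists r, [/\ c1 r = c1 e, g e = U e / U r & g e' = U e' / U r].
  rewrite /g -ec1; case: pickP => [r /eqP re|/(_ e)]; last by rewrite eqxx.
  by exists r.
have cl i : `|sigma i (g e) - sigma i (g e')| < 1.
  have : c2 e i = c2 e' i by rewrite ec2.
  rewrite !ffunE => /(congr1 val) /=.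
  have bd x : `|sigma i x| < 2 ^+ n.+1 -> 0 <= sigma i x + M%:R < (2 * M).+1%:R.
    rewrite -natrX -/M ltr_norml => /andP[lb ub]; rewrite -natr1 natrM.
    by apply/andP; split; lra.
  have /andP[b1 b2] : 0 <= sigma i (g e) + M%:R < (2 * M).+1%:R.
    by rewrite ge bd // quot_bound.
  have /andP[b3 b4] : 0 <= sigma i (g e') + M%:R < (2 * M).+1%:R.
    by rewrite ge' bd // quot_bound // re.
  rewrite !inordK ?truncn_lt_nat // => /(truncn_eq_dist b1 b3).
  by rewrite opprD addrACA subrr addr0.
have Ig x : integer_unit (U x / U r).
  by apply: integer_unitM => //; apply: integer_unitV.
have : g e = g e'.
  by apply: units_close_eq cl; rewrite ?ge ?ge'; [case: (Ig e)|case: (Ig e')].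
rewrite ge ge' => /mulIf; rewrite invr_eq0 integer_unit_neq0 // => /(_ isT) eU.
have := indep (fun j => (e j)%:Z - (e' j)%:Z).
have -> : \prod_j u j ^ ((e j)%:Z - (e' j)%:Z) = 1.
  have eE j : u j ^ ((e j)%:Z - (e' j)%:Z) = u j ^+ e j / u j ^+ e' j.
    by rewrite expfzDr ?u0 // -exprnN.
  under eq_bigr do rewrite eE.
  by rewrite big_split prodfV /= -/(U e) -/(U e') eU mulfV // integer_unit_neq0.
move=> /(_ erefl) ej; case/eqP: ne_ee'; apply/ffunP => j; apply/val_inj/eqP.
by rewrite -eqz_nat -subr_eq0 ej.
Qed.

End UnitRankBound.

(** * Independent units *)

(** Take the positive root of x^2 - e x - 1; it exceeds 1 since its discriminant e^2 + 4 exceeds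
    4. *)
Lemma exists_sub_inv (R : rcfType) (e : R) : 0 < e ->
  exists2 a : R, 1 < a & a - a^-1 = e.
Proof.
move=> e0; pose s := Num.sqrt (e ^+ 2 + 4).
have s2 : s ^+ 2 = e ^+ 2 + 4 by rewrite sqr_sqrtr //; nra.
have sg : 2 < s by rewrite -(ltr_pXn2r (ltn0Sn 1)) ?nnegrE ?sqrtr_ge0 // s2; nra.
exists ((e + s) / 2); first lra.
have nz : (e + s) / 2 != 0 by rewrite lt0r_neq0 //; lra.
have E : (e + s) / 2 * ((e + s) / 2 - e) = 1 by nra.
have -> : ((e + s) / 2)^-1 = (e + s) / 2 - e.
  by apply: (mulfI nz); rewrite mulfV // E.
by rewrite opprB addrC subrK.
Qed.

Lemma sub_inv_ltr (R : realFieldType) (a b : R) : 0 < a -> 0 < b ->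
  b - b^-1 < a - a^-1 -> b < a.
Proof.
move=> a0 b0; apply: contraTT; rewrite -!leNgt => le_ab.
by apply: lerB => //; rewrite lef_pV2.
Qed.

(** The two values of x - 1/x are the roots (t + s)/2 and (t - s)/2 of y^2 - t y + 1. The
    inequalities are those needed for the independence of the units: 1 < b < a for monotonicity, 1 <
    a - 1/a to read off a vanishing exponent. *)
Lemma fpoly_real_roots (R : rcfType) (t : int) : 4 <= t ->
  exists a b : R, [/\ 1 < b, b < a, 1 < a - a^-1,
    root (fpoly_in R t) a & root (fpoly_in R t) b].
Proof.
move=> t4; have t4R : 4 <= t%:~R :> R by rewrite (ler_int _ 4).
pose T : R := t%:~R; pose s := Num.sqrt (T ^+ 2 - 4).
have s2 : s ^+ 2 = T ^+ 2 - 4 by rewrite sqr_sqrtr // /T; nra.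
have s0 : 0 <= s by rewrite sqrtr_ge0.
have s1 : 1 < s by rewrite -(ltr_pXn2r (ltn0Sn 1)) ?nnegrE // s2 /T; nra.
have sT : s < T by rewrite -(ltr_pXn2r (ltn0Sn 1)) ?nnegrE // ?s2 /T; lra.
have [|a a1 aE] := @exists_sub_inv R ((T + s) / 2); first lra.
have [|b b1 bE] := @exists_sub_inv R ((T - s) / 2); first lra.
exists a, b; split=> //.
- by apply: sub_inv_ltr; rewrite ?aE ?bE; lra.
- by rewrite aE /T; lra.
- by rewrite root_fpolyE ?aE -?/T ?lt0r_neq0 ?(lt_trans ltr01) //; apply/eqP; nra.
- by rewrite root_fpolyE ?bE -?/T ?lt0r_neq0 ?(lt_trans ltr01) //; apply/eqP; nra.
Qed.

Lemma moebius_ltr (R : realFieldType) (a b : R) : 1 < b -> b < a ->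
  1 < (a + 1) / (a - 1) < (b + 1) / (b - 1).
Proof.
move=> b1 ba; have a1 : 0 < a - 1 by lra.
have b1' : 0 < b - 1 by lra.
rewrite ltr_pdivlMr // mul1r ltr_pdivrMr // mulrAC ltr_pdivlMr //.
by apply/andP; split; nra.
Qed.

(* x increases from b to a while (x + 1) / (x - 1) decreases. *)
Lemma moebius_power_neq (R : realFieldType) (a b : R) (l : int) (m : nat) :
  1 < b -> b < a -> (0 < m)%N ->
  a ^ l = ((a + 1) / (a - 1)) ^+ m -> b ^ l = ((b + 1) / (b - 1)) ^+ m -> False.
Proof.
move=> b1 ba m0; have /andP[U1 Uab] := moebius_ltr b1 ba.
have a1 : 1 < a by apply: lt_trans ba.
have Um : 1 < ((a + 1) / (a - 1)) ^+ m by rewrite exprn_egt1 // -lt0n.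
have Uabm : ((a + 1) / (a - 1)) ^+ m < ((b + 1) / (b - 1)) ^+ m.
  by rewrite ltr_pXn2r // nnegrE; lra.
case: l => l; last first.
  rewrite NegzE -exprnN => aE; move: Um.
  rewrite -aE invf_gt1 ?exprn_gt0 ?(lt_trans ltr01) //.
  by rewrite ltNge exprn_ege1 // ltW.
rewrite -!exprnP => aE bE; move: Uabm; rewrite -aE -bE ltNge => /negP[].
by rewrite lerXn2r ?nnegrE ?ltW // (lt_trans ltr01) // (lt_trans b1).
Qed.

Lemma normrXz (R : realFieldType) (x : R) (n : int) : `|x ^ n| = `|x| ^ n.
Proof. by case: n => n; rewrite ?NegzE -?exprnN -?exprnP ?normfV normrX. Qed.

Lemma conjugate_units_independent (R : realFieldType) (a b : R) (l m n : int) :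
  1 < b -> b < a -> 1 < a - a^-1 ->
  (forall x, x \in [:: a; b; - a^-1] -> x ^ l * (x - 1) ^ m * (x + 1) ^ n = 1) ->
  [/\ l = 0, m = 0 & n = 0].
Proof.
move=> b1 ba e1 P.
have a1 : 1 < a by apply: lt_trans ba.
have a0 : 0 < a by apply: lt_trans a1.
have b0 : 0 < b by apply: lt_trans b1.
have Pa : a ^ l * (a - 1) ^ m * (a + 1) ^ n = 1 by apply: P; rewrite !inE eqxx.
have Pb : b ^ l * (b - 1) ^ m * (b + 1) ^ n = 1.
  by apply: P; rewrite !inE eqxx orbT.
(* At -1/a some of the bases are negative; absolute values remove the signs and exchange a - 1 with
   a + 1, up to division by a. *)
have Pa' : (a^-1) ^ l * ((a + 1) / a) ^ m * ((a - 1) / a) ^ n = 1.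
  have := congr1 Num.norm (P (- a^-1) _); rewrite !inE eqxx !orbT => /(_ isT).
  rewrite normr1 !normrM !normrXz normrN ger0_norm ?invr_ge0 ?ltW //.
  have -> : - a^-1 - 1 = - ((a + 1) / a) by field; rewrite lt0r_neq0.
  have -> : - a^-1 + 1 = (a - 1) / a by field; rewrite lt0r_neq0.
  by rewrite normrN !ger0_norm // divr_ge0 ?ltW //; lra.
have nm : n = - m.
  (* This is the product of the relations at a and at -1/a: the powers of a with exponent l
     cancel. *)
  have : (a - a^-1) ^ (m + n) = 1.
    rewrite expfzDr; last by rewrite lt0r_neq0 // (lt_trans ltr01).
    have e1E : a - a^-1 = (a - 1) * ((a + 1) / a) by field; rewrite lt0r_neq0.
    have e2E : a - a^-1 = (a + 1) * ((a - 1) / a) by field; rewrite lt0r_neq0.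
    rewrite [in X in X * _]e1E e2E !expfzMl.
    have aa : a ^ l * a^-1 ^ l = 1.
      by rewrite -expfzMl mulfV ?exp1rz // lt0r_neq0.
    transitivity (a ^ l * (a - 1) ^ m * (a + 1) ^ n *
      (a^-1 ^ l * ((a + 1) / a) ^ m * ((a - 1) / a) ^ n)); last first.
      by rewrite Pa Pa' mulr1.
    by rewrite -[LHS]mul1r -aa !expfzMl; ring.
  move/eqP; rewrite pexprz_eq1; last by rewrite ltW // (lt_trans ltr01).
  by rewrite (gt_eqF e1) orbF addrC => /eqP/eqP; rewrite addr_eq0 => /eqP.
have powE (x : R) : 1 < x -> x ^ l * (x - 1) ^ m * (x + 1) ^ n = 1 ->
    x ^ l = ((x + 1) / (x - 1)) ^ m.
  move=> x1; rewrite nm => E.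
  have x1' : x - 1 != 0 by rewrite lt0r_neq0 // subr_gt0.
  have x2' : x + 1 != 0 by rewrite lt0r_neq0 // addr_gt0 // (lt_trans ltr01).
  rewrite expfzMl exprz_inv.
  apply: (mulIf (expfz_neq0 m x1')).
  rewrite -[RHS]mulrA -expfzDr // addNr expr0z mulr1.
  by apply: (mulIf (expfz_neq0 (- m) x2')); rewrite E -expfzDr // subrr expr0z.
have Ea := powE a a1 Pa; have Eb := powE b b1 Pb.
suff m0 : m = 0.
  split=> //; last by rewrite nm m0 oppr0.
  move: Ea; rewrite m0 expr0z => /eqP; rewrite pexprz_eq1 ?ltW //.
  by rewrite (gt_eqF a1) orbF => /eqP.
(* A negative m is made positive by inverting both sides, which negates l. *)
case: m Ea Eb {P Pa Pb Pa' nm powE} => -[|m] Ea Eb //.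
- by case: (@moebius_power_neq _ a b l m.+1).
- case: (@moebius_power_neq _ a b (- l) 1) => //.
  + by rewrite -invr_expz Ea NegzE -exprnN invrK.
  + by rewrite -invr_expz Eb NegzE -exprnN invrK.
- case: (@moebius_power_neq _ a b (- l) m.+2) => //.
  + by rewrite -invr_expz Ea NegzE -exprnN invrK.
  + by rewrite -invr_expz Eb NegzE -exprnN invrK.
Qed.

(** The four distinct real roots give four embeddings, which supply the norm bound behind the
    dependence of any four units. Conversely, a relation between alpha, alpha - 1 and alpha + 1 is
    carried by three of the embeddings to a, b and -1/a. *)
Lemma unit_rank_Kt_embedded (R : archiRcfType) (t : int)
    (K : fieldExtType rat) (alpha : K) : 4 <= t ->
  is_Kt t alpha -> unit_rank K 3.
Proof.
move=> t4 Kt; have dimK := dim_Kt t4 Kt; case: Kt => f_alpha K_alpha.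
have [a [b [b1 ba e1 fa fb]]] := fpoly_real_roots R t4.
have a0 : 0 < a by apply: lt_trans (lt_trans b1 ba).
have b0 : 0 < b by apply: lt_trans b1.
have embed x : root (fpoly_in R t) x ->
    exists sigma : {rmorphism K -> R}, sigma alpha = x.
  move=> fx; apply: (exists_embedding (irreducible_fpoly_in t4)) => //.
    by rewrite fpoly_in_map.
  by rewrite fpoly_in_map.
pose r : 4.-tuple R := [tuple a; b; - a^-1; - b^-1].
have ur : uniq r.
  have ai : 0 < a^-1 by rewrite invr_gt0.
  have bi : 0 < b^-1 by rewrite invr_gt0.
  rewrite /= !inE !negb_or eqr_opp (inj_eq invr_inj) (gt_eqF ba) /=.
  by rewrite !gt_eqF //; lra.
have /fin_all_exists[sigma sigmaE] (i : 'I_4) :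
    exists sigma : {rmorphism K -> R}, sigma alpha = tnth r i.
  apply: embed; have := mem_tnth i r; move: (tnth r i) => x.
  by rewrite !inE => /or4P[]/eqP->; rewrite ?fa ?fb ?root_fpoly_invN.
have sigma_inj : injective (fun i => sigma i alpha).
  by move=> i j /=; rewrite !sigmaE => /(tuple_uniqP r ur).
have [Ua Ub Uc] := root_fpoly_units f_alpha.
split; last first.
  move=> u Uu; apply: (@units_dependent K R 3 sigma) => // x Ix x0.
  exact: (norm_ge1 K_alpha dimK sigma_inj).
pose u : 3.-tuple K := [tuple alpha; alpha - 1; alpha + 1].
exists (tnth u); split.
  by move=> i; have := mem_tnth i u; rewrite !inE => /or3P[]/eqP->.
move=> n; rewrite !big_ord_recl big_ord0 mulr1 !(tnth_nth 0) /= => E.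
have [|n0 n1 n2 i] := conjugate_units_independent b1 ba e1 (l := n ord0)
  (m := n (lift ord0 ord0)) (n := n (lift ord0 (lift ord0 ord0))).
  move=> x; rewrite !inE => xr; have [|s sE] := embed x.
    by case/or3P: xr => /eqP->; rewrite ?fa ?fb ?root_fpoly_invN.
  have sB : s (alpha - 1) = s alpha - 1 by rewrite rmorphB rmorph1.
  have sD : s (alpha + 1) = s alpha + 1 by rewrite rmorphD rmorph1.
  by rewrite -sE -sB -sD -!fmorphXz -!rmorphM -mulrA E rmorph1.
case: (unliftP ord0 i) => [j|] -> //; case: (unliftP ord0 j) => [k|] -> //.
by rewrite (ord1 k).
Qed.

Lemma unit_rank_Kt (t : int) (K : fieldExtType rat) (alpha : K) : 4 <= t ->
  is_Kt t alpha -> unit_rank K 3.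
Proof. exact: (@unit_rank_Kt_embedded realalg). Qed.

(** * Pell's equation *)

Lemma sqr_rat_int (q : rat) (n : int) : q ^+ 2 = n%:~R ->
  exists m : int, n = m ^+ 2.
Proof.
move=> qn; have [|m qm] := @integral_rat_int rat q.
  exists ('X^2 - n%:P); first exact: monicXnsubC.
  rewrite rmorphB /= map_polyXn map_polyC rootE !hornerE -rmorphXn qn.
  by rewrite /= rmorph_int subrr.
exists m; apply: (intr_inj (R := rat)).
by rewrite -qn qm rmorphXn.
Qed.

(** A rational square root of an integer is an integer, and none lies strictly between m and m +
    1. *)
Lemma between_squares (n m : int) : 0 <= m -> m ^+ 2 < n < (m + 1) ^+ 2 ->
  forall q : rat, q ^+ 2 != n%:~R.
Proof.
move=> m0 mn q; apply/eqP => /sqr_rat_int[k nk].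
move: mn; rewrite nk -(real_normK (num_real k)) -abszE.
move: (absz k) => a /andP[lo hi]; case: (leP a%:Z m) => am.
  by move: lo; rewrite ltNge lerXn2r.
by move: hi; rewrite ltNge lerXn2r ?nnegrE ?addr_ge0 ?lezD1.
Qed.

Lemma squarefree_not_sqr (d : nat) : (1 < d)%N -> squarefree d ->
  forall q : rat, q ^+ 2 != d%:~R.
Proof.
move=> d1 sf q; apply/eqP => /sqr_rat_int[k dk].
have dE : d = (absz k ^ 2)%N by rewrite -abszX -dk.
by have := sf (absz k); rewrite -dE dvdnn => /(_ isT) k1; rewrite dE k1 in d1.
Qed.

Section Pell.

Variables (R : archiRcfType) (d : nat).
Hypothesis d_not_sqr : forall q : rat, q ^+ 2 != d%:~R.

Let s : R := Num.sqrt d%:R.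

Lemma sqr_neq_dmul (x y : int) : 0 < y -> x ^+ 2 != d%:Z * y ^+ 2.
Proof.
move=> y0; have yq : y%:~R != 0 :> rat by rewrite intr_eq0 gt_eqF.
apply: contra (d_not_sqr (x%:~R / y%:~R)) => /eqP E.
by rewrite exprMn -rmorphXn E rmorphM rmorphXn /= exprVn mulfK // sqrf_eq0.
Qed.

(** Pigeonhole: of the N + 1 fractional parts of i s, for i from 0 to N, two fall into the same one
    of N intervals of length 1/N. *)
Lemma dirichlet_approx (N : nat) : (0 < N)%N ->
  exists x y : int, [/\ 0 < y, y <= N%:Z & N%:R * `|x%:~R - y%:~R * s| < 1].
Proof.
move=> N0; have NR : (0 : R) < N%:R by rewrite ltr0n.
pose fl (i : 'I_N.+1) := Num.floor (i%:R * s).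
pose fr (i : 'I_N.+1) := i%:R * s - (fl i)%:~R.
have fr_itv i : 0 <= N%:R * fr i < N%:R.
  have /andP[f1 f2] := floor_itv (i%:R * s); rewrite rmorphD /= in f2.
  rewrite mulr_ge0 ?ler0n /fr ?subr_ge0 //= -[ltRHS]mulr1 ltr_pM2l //.
  by rewrite ltrBlDl.
pose cell i : 'I_N.-1.+1 := inord (Num.truncn (N%:R * fr i)).
have /injectivePn[i [j ne_ij cij]] : ~~ injectiveb cell.
  by apply/negP => /injectiveP/leq_card; rewrite !card_ord prednK // ltnn.
have : `|N%:R * fr i - N%:R * fr j| < 1.
  have /andP[i0 i1] := fr_itv i; have /andP[j0 j1] := fr_itv j.
  apply: truncn_eq_dist => //; have := congr1 val cij.
  by rewrite /= !inordK // prednK // truncn_lt_nat.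
rewrite -mulrBr normrM ger0_norm ?ler0n // => close.
wlog lt_ij : i j ne_ij cij close / (i < j)%N.
  move=> IH; case: (ltngtP i j) => [/IH|lt|/val_inj eq_ij]; first by apply.
    by apply: (IH j i); rewrite // 1?eq_sym // distrC.
  by rewrite eq_ij eqxx in ne_ij.
exists (fl j - fl i), (j%:Z - i%:Z); split; rewrite ?subr_gt0 ?ltz_nat //.
  by have := ltn_ord j; lia.
have -> : (fl j - fl i)%:~R - (j%:Z - i%:Z)%:~R * s = fr i - fr j :> R => //.
by rewrite /fr !rmorphB /= -!pmulrn; ring.
Qed.

Lemma sqrt_natE : s ^+ 2 = d%:R.
Proof. by rewrite sqr_sqrtr ?ler0n. Qed.

(** With e = |x - y s|, the norm is at most e (e + 2 y s). Dirichlet's bound gives e < 1 and e y <=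
    1, and s <= d + 1, whence 1 + 2 (d + 1) = 2d + 3. *)
Lemma small_norm_approx (delta : R) : 0 < delta ->
  exists x y : int, [/\ 0 < y, `|x%:~R - y%:~R * s| < delta &
    (absz (x ^+ 2 - d%:Z * y ^+ 2)%R <= 2 * d + 3)%N].
Proof.
move=> delta0; pose N := (Num.truncn delta^-1).+1.
have NR : (0 : R) < N%:R by rewrite ltr0n.
have [//|x [y [y0 yN close]]] := @dirichlet_approx N.
exists x, y; split=> //.
  rewrite -(ltr_pM2l NR) (lt_trans close) //.
  by rewrite -ltr_pdivrMr // div1r truncnS_gt.
have s0 : 0 <= s by rewrite sqrtr_ge0.
have d0 : 0 <= d%:R :> R by rewrite ler0n.
have sd : s <= d%:R + 1.
  by rewrite -(ler_pXn2r (ltn0Sn 1)) ?nnegrE ?addr_ge0 // sqrt_natE; nra.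
have yR : 0 < y%:~R :> R by rewrite ltr0z.
have yNR : y%:~R <= N%:R :> R by rewrite pmulrn ler_int.
have N1 : 1 <= N%:R :> R by rewrite ler1n.
rewrite -lez_nat abszE -(ler_int R) intr_norm.
have -> : (x ^+ 2 - d%:Z * y ^+ 2)%:~R =
    (x%:~R - y%:~R * s) * (x%:~R - y%:~R * s + 2 * (y%:~R * s)) :> R.
  by rewrite !(rmorphB, rmorphXn, rmorphM) /= -pmulrn -sqrt_natE; ring.
rewrite normrM; set e := `|x%:~R - _|.
have e0 : 0 <= e := normr_ge0 _.
have e1 : e < 1 by apply: le_lt_trans close; rewrite ler_peMl.
have le1 : `|x%:~R - y%:~R * s + 2 * (y%:~R * s)| <= e + 2 * (y%:~R * s).
  by rewrite (le_trans (ler_normD _ _)) // lerD2l ger0_norm ?mulr_ge0 // ltW.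
apply: le_trans (ler_wpM2l e0 le1) _.
rewrite -pmulrn natrD natrM mulrDr.
have ee : e * e <= 1 by nra.
have ey : e * y%:~R <= 1 by rewrite mulrC (le_trans _ (ltW close)) // ler_wpM2r.
have eys : e * y%:~R * s <= d%:R + 1 by apply: le_trans sd; rewrite ler_piMl.
by lra.
Qed.

(** By induction, keeping a lower bound [delta] for the distances already used: a new pair closer
    than [delta] is not in the list, and its own distance, nonzero as s is irrational, is the next
    [delta]. *)
Lemma many_small_norms (m : nat) : exists l : seq (int * int),
  [/\ size l = m, uniq l & forall p, p \in l ->
     0 < p.2 /\ (absz (p.1 ^+ 2 - d%:Z * p.2 ^+ 2)%R <= 2 * d + 3)%N].
Proof.
suff [l [delta [sl ul [delta0 lP]]]] : exists l : seq (int * int), exists delta : R,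
  [/\ size l = m, uniq l & 0 < delta /\ forall p, p \in l ->
     [/\ 0 < p.2, (absz (p.1 ^+ 2 - d%:Z * p.2 ^+ 2)%R <= 2 * d + 3)%N
       & delta <= `|p.1%:~R - p.2%:~R * s|]].
  by exists l; split=> // p /lP[].
elim: m => [|m [l [delta [sl ul [delta0 lP]]]]]; first by exists [::], 1.
have [x [y [y0 xy nxy]]] := small_norm_approx delta0.
exists ((x, y) :: l), `|x%:~R - y%:~R * s|; split.
- by rewrite /= sl.
- rewrite /= ul andbT; apply/negP => /lP[_ _] /=.
  by rewrite leNgt xy.
split=> [|p].
  rewrite normr_gt0 subr_eq0; apply: contra (sqr_neq_dmul x y0) => /eqP E.
  apply/eqP/(intr_inj (R := R)); rewrite rmorphXn /= E exprMn sqrt_natE.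
  by rewrite rmorphM rmorphXn /= mulrC.
rewrite inE => /orP[/eqP-> //|/lP[? ? ?]]; split=> //.
by rewrite ltW // (lt_le_trans xy).
Qed.

(** The solution is the quotient of x1 - y1 s by x2 - y2 s, two elements of norm k; the congruences
    modulo k make its coordinates integral. *)
Lemma pell_quotient (x1 y1 x2 y2 k : int) : k != 0 ->
  x1 ^+ 2 - d%:Z * y1 ^+ 2 = k -> x2 ^+ 2 - d%:Z * y2 ^+ 2 = k ->
  (x1 = x2 %[mod k])%Z -> (y1 = y2 %[mod k])%Z -> 0 < y1 -> 0 < y2 ->
  (x1, y1) != (x2, y2) ->
  exists x y : int, x ^+ 2 - d%:Z * y ^+ 2 = 1 /\ y != 0.
Proof.
move=> k0 E1 E2 /eqP; rewrite eqz_mod_dvd => /dvdzP[u xu].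
move=> /eqP; rewrite eqz_mod_dvd => /dvdzP[v yv] y10 y20 ne.
have {}xu : x1 = x2 + u * k by rewrite -xu addrC subrK.
have {}yv : y1 = y2 + v * k by rewrite -yv addrC subrK.
pose X := 1 + u * x2 - d%:Z * v * y2; pose Y := u * y2 - v * x2.
have XE : X * k = x1 * x2 - d%:Z * y1 * y2.
  transitivity (x2 ^+ 2 - d%:Z * y2 ^+ 2 + (u * x2 - d%:Z * v * y2) * k).
    by rewrite E2 /X; ring.
  by rewrite xu yv; ring.
have YE : Y * k = x1 * y2 - x2 * y1 by rewrite /Y xu yv; ring.
exists X, Y; split.
  apply: (mulIf (_ : k ^+ 2 != 0)); first by rewrite sqrf_eq0.
  transitivity ((X * k) ^+ 2 - d%:Z * (Y * k) ^+ 2); first by ring.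
  transitivity ((x1 ^+ 2 - d%:Z * y1 ^+ 2) * (x2 ^+ 2 - d%:Z * y2 ^+ 2)).
    by rewrite XE YE; ring.
  by rewrite E1 E2; ring.
(* If Y = 0 the two pairs are proportional; having the same norm and positive second coordinates,
   they coincide. *)
apply/negP => /eqP Y0; move: YE; rewrite Y0 mul0r => /eqP.
rewrite eq_sym subr_eq0 => /eqP xy.
have yy : y1 ^+ 2 = y2 ^+ 2.
  apply: (mulfI k0); transitivity ((x2 * y1) ^+ 2 - d%:Z * y1 ^+ 2 * y2 ^+ 2).
    by rewrite -E2; ring.
  by rewrite -xy -E1; ring.
have y12 : y1 = y2 by apply/eqP; rewrite -(eqrXn2 (isT : (0 < 2)%N)) ?ltW // yy.
case/eqP: ne; congr (_, _) => //; apply: (mulIf (_ : y2 != 0)).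
  by rewrite gt_eqF.
by rewrite xy y12.
Qed.

Lemma pell_solution : exists x y : int, x ^+ 2 - d%:Z * y ^+ 2 = 1 /\ y != 0.
Proof.
pose B := (2 * d + 3)%N; pose nm (p : int * int) := p.1 ^+ 2 - d%:Z * p.2 ^+ 2.
pose T : finType := ('I_(2 * B).+1 * ('I_B.+1 * 'I_B.+1))%type.
(* The norm lies between -B and B, so adding B lets [absz] lose nothing; the residues modulo the
   norm lie between 0 and B, so [inord] does not fall back on its default. *)
pose c p : T := (inord (absz (nm p + B%:Z)%R),
  (inord (absz (p.1 %% nm p)%Z), inord (absz (p.2 %% nm p)%Z))).
have [l [sl ul lP]] := many_small_norms #|T|.+1.
have : ~~ uniq (map c l).
  apply/negP => /card_uniqP; rewrite size_map sl => E.
  by have := max_card (mem (map c l)); rewrite E ltnn.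
case/(uniqPn (c (0, 0))) => i [j [lt_ij]]; rewrite size_map => lt_j.
have lt_i := ltn_trans lt_ij lt_j.
rewrite !(nth_map (0, 0)) //.
have pl := mem_nth (0, 0) lt_i; have ql := mem_nth (0, 0) lt_j.
have ne : nth (0, 0) l i != nth (0, 0) l j by rewrite nth_uniq // ltn_eqF.
move: (nth _ l i) (nth _ l j) pl ql ne => [x1 y1] [x2 y2] /lP[y10 n1] /lP[y20 n2] ne.
have k0 : nm (x1, y1) != 0 by rewrite subr_eq0 sqr_neq_dmul.
rewrite -!/(nm (_, _)) -/B in n1 n2; rewrite /= in y10 y20.
rewrite /c => -[] /(congr1 val) /= e1 /(congr1 val) /= e2 /(congr1 val) /= e3.
have nE : nm (x1, y1) = nm (x2, y2).
  by move: e1; rewrite !inordK; lia.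
have md x p : (absz (nm p) <= B)%N -> nm p != 0 -> (absz (x %% nm p)%Z < B.+1)%N.
  move=> nB p0; have := ltz_mod x p0; have := modz_ge0 x p0; lia.
have k0' : nm (x2, y2) != 0 by rewrite -nE.
move: e2 e3; rewrite !inordK ?md // -nE => e2 e3.
have md0 x := modz_ge0 x k0.
apply: (@pell_quotient x1 y1 x2 y2 (nm (x1, y1))) => //.
- by rewrite -(gez0_abs (md0 x1)) e2 gez0_abs.
- by rewrite -(gez0_abs (md0 y1)) e3 gez0_abs.
Qed.

End Pell.

(** * The Galois group *)

Lemma intr_fieldExt_eq0 (K : fieldExtType rat) (m : int) :
  (m%:~R == 0 :> K) = (m == 0).
Proof.
by rewrite -(rmorph_int (in_alg K)) fmorph_eq0 intr_eq0.
Qed.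

(** It lies strictly between (2t)^2 and (2t + 1)^2, because 9 < 4t + 1. *)
Lemma quadratic_not_sqr (t : int) : 4 <= t ->
  forall q : rat, q ^+ 2 != (4 * t ^+ 2 + 9)%:~R.
Proof.
move=> t4; apply: (@between_squares _ (2 * t)); first lia.
have -> : (2 * t) ^+ 2 = 4 * t ^+ 2 by ring.
have -> : (2 * t + 1) ^+ 2 = 4 * t ^+ 2 + (4 * t + 1) by ring.
by move: (t ^+ 2) => u; lia.
Qed.

(** The product equals (2t^2 - 2)^2 + t^2 - 40, which for t >= 7 lies strictly between the squares
    of 2t^2 - 2 and 2t^2 - 1; the values t = 4, 5, 6 are treated one by one. *)
Lemma quartic_not_sqr (t : int) : 4 <= t ->
  forall q : rat, q ^+ 2 != ((4 * t ^+ 2 + 9) * (t ^+ 2 - 4))%:~R.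
Proof.
move=> t4; have [t7|t7] := leP 7 t.
  have u7 : 49 <= t ^+ 2 by nia.
  apply: (@between_squares _ (2 * t ^+ 2 - 2)).
    by move: (t ^+ 2) u7 => u; lia.
  by move: (t ^+ 2) u7 => u u7; apply/andP; split; nia.
have /or3P[/eqP->|/eqP->|/eqP->] : [|| t == 4, t == 5 | t == 6] by lia.
- exact: (@between_squares _ 29).
- exact: (@between_squares _ 47).
- exact: (@between_squares _ 69).
Qed.

Section SplittingField.

Variables (t : int) (L : splittingFieldType rat).
Hypothesis t4 : 4 <= t.
Hypothesis splitL : splittingFieldFor 1 (fpoly_in L t) {:L}%VS.

Notation G := 'Gal({:L} / 1)%g.
Notation f := (fpoly_in L t).

(** Equality means x^2 = -1, so f(x) = 0 reduces to 2 t x = -3, and squaring gives 4 t^2 + 9 = 0. *)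
Lemma root_neq_invN (x : L) : root f x -> x != - x^-1.
Proof.
move=> fx; have x0 := root_fpoly_neq0 fx; apply/eqP => xE.
have x2 : x ^+ 2 = -1 by rewrite expr2 {2}xE mulrN mulfV.
have : (9 + 4 * t ^+ 2)%:~R == 0 :> L.
  move: fx; rewrite root_fpoly_in => /eqP fx.
  have E : 2 * (t%:~R * x) = - 3 :> L.
    apply/eqP; rewrite -subr_eq0 -[X in _ == X]fx; apply/eqP.
    have -> : x ^+ 4 = 1 by rewrite (exprM x 2 2) x2 sqrrN expr1n.
    have -> : x ^+ 3 = - x by rewrite exprS x2 mulrN1.
    by rewrite x2; ring.
  have -> : (9 + 4 * t ^+ 2)%:~R =
      (2 * (t%:~R * x)) ^+ 2 - (2 * t%:~R) ^+ 2 * x ^+ 2 :> L.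
    rewrite E x2 !(rmorphD, rmorphM, rmorphXn) /=; ring.
  by rewrite !exprMn mulrA subrr.
by rewrite intr_fieldExt_eq0; move: t4; nia.
Qed.

Lemma sub_inv_quad (x : L) : root f x ->
  (x - x^-1) ^+ 2 - t%:~R * (x - x^-1) + 1 = 0.
Proof.
by move=> fx; apply/eqP; rewrite -root_fpolyE // (root_fpoly_neq0 fx).
Qed.

Lemma discr_neq0 (e : L) : e ^+ 2 - t%:~R * e + 1 = 0 -> e != t%:~R - e.
Proof.
move=> eE; apply/eqP => e2.
have : (t ^+ 2 - 4)%:~R == 0 :> L.
  have -> : (t ^+ 2 - 4)%:~R =
      (e - (t%:~R - e)) ^+ 2 - 4 * (e ^+ 2 - t%:~R * e + 1) :> L.
    by rewrite rmorphB rmorphXn /=; ring.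
  by rewrite -e2 subrr eE expr0n /= mulr0 subr0.
by rewrite intr_fieldExt_eq0; move: t4; nia.
Qed.

Lemma sub_inv_eq (x y : L) : x != 0 -> y != 0 -> x - x^-1 = y - y^-1 ->
  y = x \/ y = - x^-1.
Proof.
move=> x0 y0 xy; have : (y - x) * (y + x^-1) = 0.
  have -> : (y - x) * (y + x^-1) = y * ((y - y^-1) - (x - x^-1)).
    by field; apply/andP.
  by rewrite xy subrr mulr0.
by move/eqP; rewrite mulf_eq0 subr_eq0 addr_eq0 => /orP[]/eqP; [left|right].
Qed.

Lemma root_gal (g : gal_of {:L}) (x : L) : root f x -> root f (g x).
Proof. by rewrite -(fmorph_root g) fpoly_in_map. Qed.

Lemma galVN (g : gal_of {:L}) (x : L) : g (- x^-1) = - (g x)^-1.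
Proof. by rewrite rmorphN fmorphV. Qed.

Lemma gal_transitive (x y : L) : root f x -> root f y ->
  exists2 g, g \in G & g x = y.
Proof.
move=> fx fy; apply: normalField_root_minPoly; rewrite ?sub1v ?memvf //.
  exact: normalFieldf.
by rewrite (minPoly_fpoly t4 fx).
Qed.

(** With e = a - 1/a, f factors over L as (x^2 - e x - 1)(x^2 - (t - e) x - 1). Since f splits in L,
    so does the second factor, and any root of it will do. *)
Lemma root_partner (a : L) : root f a ->
  exists2 b, root f b & b - b^-1 = t%:~R - (a - a^-1).
Proof.
move=> fa; have [rs f_rs _] := splitL.
move: (a - a^-1) (sub_inv_quad fa) => e eE.
pose p e' : {poly L} := 'X^2 - e' *: 'X - 1.
have fE : f = p e * p (t%:~R - e).
  rewrite fpoly_inE /p -!mul_polyC polyCB.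
  have E : e%:P ^+ 2 - (t%:~R)%:P * e%:P + 1 = 0 :> {poly L}.
    by rewrite -polyC_exp -polyCM -polyCB -polyCD eE.
  apply/eqP; rewrite -subr_eq0; apply/eqP.
  transitivity ('X^2 * (e%:P ^+ 2 - (t%:~R)%:P * e%:P + 1) : {poly L}); first ring.
  by rewrite E mulr0.
have : p (t%:~R - e) %| f by rewrite fE dvdp_mull.
have sp e' : size (p e') = 3.
  rewrite /p -addrA size_polyDl size_polyXn // -opprD size_polyN ltnS.
  by rewrite (leq_trans (size_polyD _ _)) // geq_max size_poly1
    (leq_trans (size_scale_leq _ _)) ?size_polyX.
rewrite (eqp_dvdr _ f_rs) => /dvdp_prod_XsubC[m pm].
have := eqp_size pm; rewrite sp.
case E: (mask m rs) pm => [|b s] pm; first by rewrite big_nil size_poly1.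
move=> _; have : root (p (t%:~R - e)) b.
  by rewrite (eqp_root pm) big_cons rootM root_XsubC eqxx.
move=> pb; exists b; first by rewrite fE rootM pb orbT.
have b0 : b != 0.
  apply: contraTneq pb => ->; rewrite rootE /p !hornerE expr0n /=.
  by rewrite ?(mulr0, subrr, sub0r, oppr0, oppr_eq0, oner_eq0).
move: pb; rewrite rootE /p !hornerE => /eqP pb.
apply: (mulfI b0); rewrite mulrBr mulfV //; apply/eqP.
rewrite -subr_eq0 -[X in _ == X]pb.
by apply/eqP; ring.
Qed.

Lemma galois_L : galois 1 {:L}.
Proof.
rewrite /galois sub1v normalFieldf andbT /=; apply/separableP => u _.
by apply: pcharf0_separable; apply: (ftrans (fmorph_pchar (in_alg L)) (pchar_num _)).
Qed.

Lemma fixed_rat (w : L) : (forall g, g \in G -> g w = w) ->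
  exists q : rat, w = q%:A.
Proof.
move=> fix_w; have /galois_fixedField fG := galois_L.
have : w \in fixedField G by apply/fixedFieldP; rewrite ?memvf.
by rewrite fG => /vlineP.
Qed.

(** A normal subfield containing a contains all roots of its minimal polynomial f, and these
    generate L. *)
Lemma normal_closure_L (a : L) : root f a -> is_normal_closure <<1; a>>%VS.
Proof.
move=> fa; split=> [|E aE /normalFieldP nE]; first exact: normalFieldf.
have [rs f_rs rsL] := splitL.
have [|r /allP rE mr] := nE a; first by rewrite (subvP aE) ?memv_adjoin.
apply/eqP; rewrite eqEsubv subvf -rsL; apply/Fadjoin_seqP; split; first exact: sub1v.
move=> x xrs; apply: rE; rewrite -root_prod_XsubC -mr (minPoly_fpoly t4 fa).
by rewrite (eqp_root f_rs) root_prod_XsubC.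
Qed.

Section Pair.

Variables a b : L.
Hypotheses (fa : root f a) (fb : root f b).
Hypothesis ab : b - b^-1 = t%:~R - (a - a^-1).

Let a0 := root_fpoly_neq0 fa.
Let b0 := root_fpoly_neq0 fb.

Lemma roots_cases (x : L) : root f x -> x \in [:: a; - a^-1; b; - b^-1].
Proof.
move=> fx; have x0 := root_fpoly_neq0 fx.
have : ((x - x^-1) - (a - a^-1)) * ((x - x^-1) - (b - b^-1)) = 0.
  rewrite ab; transitivity (((x - x^-1) ^+ 2 - t%:~R * (x - x^-1) + 1)
     - ((a - a^-1) ^+ 2 - t%:~R * (a - a^-1) + 1)); first ring.
  by rewrite !sub_inv_quad // subrr.
move/eqP; rewrite mulf_eq0 !subr_eq0 => /orP[]/eqP/esym/sub_inv_eq[]// ->;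
  by rewrite !inE eqxx ?orbT.
Qed.

Lemma pair_neq : [/\ a != b, a != - b^-1, - a^-1 != b & - a^-1 != - b^-1].
Proof.
have ne := discr_neq0 (sub_inv_quad fa); rewrite -ab in ne.
split; apply: contra ne => /eqP.
- by move=> ->.
- by move=> ->; rewrite invrN invrK opprK addrC.
- by move=> <-; rewrite invrN invrK opprK [X in _ == X]addrC.
- by move=> /oppr_inj/invr_inj ->.
Qed.

Lemma gal_faithful (g : gal_of {:L}) : g a = a -> g b = b -> g = 1%g.
Proof.
move=> ga gb; have [rs f_rs rsL] := splitL.
have sub : (<<1 & rs>> <= fixedField [set g])%VS.
  apply/Fadjoin_seqP; split; first exact: sub1v.
  move=> x xrs; apply/fixedFieldP; rewrite ?memvf // => _ /set1P->.
  have /roots_cases : root f x by rewrite (eqp_root f_rs) root_prod_XsubC.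
  by rewrite !inE => /or4P[]/eqP->; rewrite ?galVN ?ga ?gb.
apply/eqP/gal_eqP => x _; rewrite gal_id.
have /subvP/(_ x) := sub; rewrite rsL memvf => /(_ isT)/mem_fixedFieldP[_].
by apply; rewrite inE.
Qed.

Lemma gal_partner (g : gal_of {:L}) (x y : L) : root f x -> root f y ->
  y - y^-1 = t%:~R - (x - x^-1) -> g y - (g y)^-1 = t%:~R - (g x - (g x)^-1).
Proof.
move=> fx fy yE; rewrite -fmorphV -rmorphB yE rmorphB rmorph_int.
by rewrite rmorphB fmorphV.
Qed.

Lemma gal_fixing_a (g : gal_of {:L}) : g a = a \/ g a = - a^-1 ->
  g b = b \/ g b = - b^-1.
Proof.
move=> ga; have := gal_partner g fa fb ab.
have -> : g a - (g a)^-1 = a - a^-1.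
  by case: ga => ->; rewrite // invrN invrK opprK addrC.
rewrite -ab => /esym/sub_inv_eq; apply=> //.
exact: root_fpoly_neq0 (root_gal g fb).
Qed.

Lemma gal_swapping (g : gal_of {:L}) : g a = b \/ g a = - b^-1 ->
  g b = a \/ g b = - a^-1.
Proof.
move=> ga; have := gal_partner g fa fb ab.
have -> : g a - (g a)^-1 = b - b^-1.
  by case: ga => ->; rewrite // invrN invrK opprK addrC.
rewrite ab subKr => /esym/sub_inv_eq; apply=> //.
exact: root_fpoly_neq0 (root_gal g fb).
Qed.

(* Otherwise the Galois group would act simply transitively on the roots, and
   the product w of the square roots of the two quadratic discriminants would
   satisfy w in Q or w sqrt(t^2-4) in Q. *)
Lemma gal_fix_swap : exists2 s : gal_of {:L}, s \in G & s a = a /\ s b = - b^-1.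
Proof.
have [/existsP[s /and3P[sG /eqP sa /eqP sb]]|/existsPn no_s] :=
  boolP [exists s : gal_of {:L}, [&& s \in G, s a == a & s b == - b^-1]].
  by exists s.
have free g : g \in G -> g a = a -> g = 1%g.
  move=> gG ga; apply: gal_faithful => //.
  case: (gal_fixing_a (or_introl ga)) => // gb.
  by have := no_s g; rewrite gG ga gb !eqxx.
have simply g h : g \in G -> h \in G -> g a = h a -> g = h.
  move=> gG hG gh; apply/eqP; rewrite eq_mulgV1; apply/eqP/free.
    by rewrite groupM ?groupV.
  by rewrite galM ?memvf // gh -galM ?memvf // mulgV gal_id.
have [neab neab' nea'b nea'b'] := pair_neq.
have nea := root_neq_invN fa.
have [tau tauG ta] := gal_transitive fa (root_fpoly_invN fa).
have [r rG ra] := gal_transitive fa fb.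
have tb : tau b = - b^-1.
  case: (gal_fixing_a (or_intror ta)) => // tb.
  have /simply : (r * tau)%g a = r a by rewrite galM ?memvf // ra.
  rewrite groupM // -[RHS]mulg1 => /(_ isT rG)/mulgI tau1.
  by move: ta nea; rewrite tau1 gal_id => <-; rewrite eqxx.
(* An automorphism is now determined by its value at a, and these four realise all four roots. *)
have cover g : g \in G -> [\/ g = 1%g, g = tau, g = r | g = (r * tau)%g].
  move=> gG; have := roots_cases (root_gal g fa).
  rewrite !inE => /or4P[]/eqP ga.
  - by apply: Or41; apply: free.
  - by apply: Or42; apply: simply; rewrite // ga ta.
  - by apply: Or43; apply: simply; rewrite // ga ra.
  - by apply: Or44; apply: simply; rewrite ?groupM // galM ?memvf // ga ra tb.
(* Here (a + 1/a)^2 = e^2 + 4 for e = a - 1/a, and likewise for b, so w^2 is the norm 4 t^2 + 9; D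
   is the difference of the roots of y^2 - t y + 1, so D^2 = t^2 - 4. *)
pose w := (a + a^-1) * (b + b^-1); pose D := (b - b^-1) - (a - a^-1).
have galE (g : gal_of {:L}) : g w = (g a + (g a)^-1) * (g b + (g b)^-1).
  by rewrite /w rmorphM !rmorphD !fmorphV.
have galD (g : gal_of {:L}) : g D = (g b - (g b)^-1) - (g a - (g a)^-1).
  by rewrite /D !rmorphB !fmorphV.
have tw : tau w = w by rewrite galE ta tb !invrN !invrK /w; ring.
have tD : tau D = D by rewrite galD ta tb !invrN !invrK /D; ring.
have fixes (z : L) : tau z = z -> r z = z -> exists q : rat, z = q%:A.
  move=> tz rz; apply: fixed_rat => g /cover[] ->; rewrite ?gal_id //.
  by rewrite galM ?memvf // rz.
have w2 : w ^+ 2 = (4 * t ^+ 2 + 9)%:~R.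
  have -> : w ^+ 2 = ((a - a^-1) ^+ 2 + 4) * ((b - b^-1) ^+ 2 + 4).
    by rewrite /w; field; rewrite a0 b0.
  rewrite ab !(rmorphD, rmorphM, rmorphXn) /=.
  move: (sub_inv_quad fa); move: (a - a^-1) => e eE.
  apply/eqP; rewrite -subr_eq0; apply/eqP.
  transitivity ((7 - t%:~R * e + e ^+ 2) * (e ^+ 2 - t%:~R * e + 1)); first ring.
  by rewrite eE mulr0.
have D2 : D ^+ 2 = (t ^+ 2 - 4)%:~R.
  rewrite /D ab !(rmorphB, rmorphXn) /=.
  move: (sub_inv_quad fa); move: (a - a^-1) => e eE.
  apply/eqP; rewrite -subr_eq0; apply/eqP.
  transitivity (4 * (e ^+ 2 - t%:~R * e + 1)); first ring.
  by rewrite eE mulr0.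
have irrat n (z : L) : z ^+ 2 = n%:~R -> (forall q : rat, q ^+ 2 != n%:~R) ->
    ~ exists q : rat, z = q%:A.
  move=> zn nsq [q zq]; have /eqP[] := nsq q; apply: (fmorph_inj (in_alg L)).
  by rewrite rmorphXn /= -zq zn; apply: esym (rmorph_int (in_alg L) n).
have rD : r D = - D.
  by rewrite galD (gal_partner r fa fb ab) ra /D ab; ring.
(* If r fixes w then w is rational; if it negates w, it fixes w D, as it also negates D, and w D is
   rational. Both squares are known to be non-squares in Q. *)
exfalso; have [rw|rw] : r w = w \/ r w = - w.
- rewrite galE ra; case: (gal_swapping (or_introl ra)) => ->; [left|right];
    by rewrite ?invrN ?invrK /w; ring.
- apply: (irrat _ _ w2 _ (fixes w tw rw)).
  exact: quadratic_not_sqr.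
- apply: (irrat ((4 * t ^+ 2 + 9) * (t ^+ 2 - 4)) (w * D)).
  + by rewrite exprMn w2 D2 -rmorphM.
  + exact: quartic_not_sqr.
  + by apply: fixes; rewrite rmorphM /= ?tw ?tD ?rw ?rD ?mulrNN.
Qed.

(** Transitivity gives r with r a = b. If it sends b to -1/a, precomposing with the automorphism
    that fixes a and moves b to -1/b corrects the sign. *)
Lemma gal_swap_pairs : exists2 r : gal_of {:L}, r \in G & r a = b /\ r b = a.
Proof.
have [s sG [sa sb]] := gal_fix_swap; have [r rG ra] := gal_transitive fa fb.
case: (gal_swapping (or_introl ra)) => rb; first by exists r.
exists (s * r)%g; first exact: groupM.
by rewrite !galM ?memvf // sa sb galVN rb invrN invrK opprK.
Qed.

(** An automorphism is determined by the images of a and b, and the partition of the roots leaves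
    eight possible pairs. Words in the involutions s and r realise all eight, so G is generated by
    two involutions and has order 8, hence is dihedral; ['D_8] is indexed by the order. *)
Lemma Gal_isog_D8 : (G \isog 'D_8)%g.
Proof.
have [s sG [sa sb]] := gal_fix_swap; have [r rG [ra rb]] := gal_swap_pairs.
have nea := root_neq_invN fa; have neb := root_neq_invN fb.
have [neab neab' nea'b nea'b'] := pair_neq.
have invo (g : gal_of {:L}) : (g * g)%g a = a -> (g * g)%g b = b ->
    g != 1%g -> #[g]%g = 2.
  by move=> ga gb g1; apply: nt_prime_order => //; apply: gal_faithful.
have os : #[s]%g = 2.
  apply: invo; rewrite ?galM ?memvf ?sa ?sb ?galVN ?sb ?invrN ?invrK ?opprK //.
  by apply: contraNneq neb => s1; rewrite -sb s1 gal_id.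
have or : #[r]%g = 2.
  apply: invo; rewrite ?galM ?memvf ?ra ?rb //.
  by apply: contraNneq neab => r1; rewrite -ra r1 gal_id.
have nsr : s != r by apply: contraNneq neab => sr; rewrite -ra -sr sa.
pose H := <<[set s; r]>>%G; pose Phi (g : gal_of {:L}) := (g a, g b).
pose P8 := [:: (a, b); (a, - b^-1); (- a^-1, b); (- a^-1, - b^-1);
               (b, a); (b, - a^-1); (- b^-1, a); (- b^-1, - a^-1)].
have Hs : s \in H by rewrite mem_gen ?set21.
have Hr : r \in H by rewrite mem_gen ?set22.
have sa' : s (- a^-1) = - a^-1 by rewrite galVN sa.
have sb' : s (- b^-1) = b by rewrite galVN sb invrN invrK opprK.
have ra' : r (- a^-1) = - b^-1 by rewrite galVN ra.
have rb' : r (- b^-1) = - a^-1 by rewrite galVN rb.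
have words p : p \in P8 -> exists2 h, h \in H & Phi h = p.
  rewrite !inE; do 7?[case/orP]; move/eqP->.
  - by exists 1%g; rewrite ?group1 // /Phi !gal_id.
  - by exists s; rewrite // /Phi sa sb.
  - exists (r * s * r)%g; first by rewrite ?groupM.
    by rewrite /Phi !galM ?memvf // ra rb sb sa ra rb'.
  - exists (r * s * r * s)%g; first by rewrite ?groupM.
    by rewrite /Phi !galM ?memvf // ra rb sb sa ra rb' sa' sb.
  - by exists r; rewrite // /Phi ra rb.
  - by exists (s * r)%g; rewrite ?groupM // /Phi !galM ?memvf // sa sb ra rb'.
  - by exists (r * s)%g; rewrite ?groupM // /Phi !galM ?memvf // ra rb sa sb.
  - exists (s * r * s)%g; first by rewrite ?groupM.
    by rewrite /Phi !galM ?memvf // sa sb ra rb' sb sa'.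
have Phi8 g : Phi g \in P8.
  have := roots_cases (root_gal g fa); rewrite !inE /Phi !xpair_eqE.
  case/or4P=> /eqP ga.
  - case: (gal_fixing_a (or_introl ga)) => ->; by rewrite ga !eqxx ?orbT.
  - case: (gal_fixing_a (or_intror ga)) => ->; by rewrite ga !eqxx ?orbT.
  - case: (gal_swapping (or_introl ga)) => ->; by rewrite ga !eqxx ?orbT.
  - case: (gal_swapping (or_intror ga)) => ->; by rewrite ga !eqxx ?orbT.
have Phi_inj : injective Phi.
  move=> g h [ga gb]; apply/eqP; rewrite eq_mulgV1; apply/eqP/gal_faithful.
    by rewrite galM ?memvf // ga -galM ?memvf // mulgV gal_id.
  by rewrite galM ?memvf // gb -galM ?memvf // mulgV gal_id.
have GH : G = H.
  apply/eqP; rewrite eqEsubset gen_subG subUset !sub1set sG rG !andbT.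
  by apply/subsetP => g _; have [h Hh /Phi_inj <-] := words _ (Phi8 g).
have uP8 : uniq P8.
  rewrite /= !inE !xpair_eqE !eqxx.
  rewrite !(negPf neab) !(negPf neab') !(negPf nea'b) !(negPf nea'b').
  by rewrite !(negPf nea) !(negPf neb).
have cardG : #|G| = 8.
  rewrite cardE -(size_map Phi); apply: (perm_size (s2 := P8)).
  apply: uniq_perm => //; first by rewrite map_inj_uniq ?enum_uniq.
  move=> p; apply/mapP/idP => [[g _ ->] //|/words[h Hh <-]].
  by exists h; rewrite // mem_enum GH.
by have := involutions_gen_dihedral os or nsr; rewrite -/H -GH cardG.
Qed.

End Pair.

Lemma splitting_root : exists a : L, root f a.
Proof.
have [rs f_rs _] := splitL; have := eqp_size f_rs.
rewrite size_fpoly_in size_prod_XsubC; case: rs f_rs => // a rs f_rs _.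
by exists a; rewrite (eqp_root f_rs) root_prod_XsubC mem_head.
Qed.

End SplittingField.

(** * Real quadratic subfields *)

Lemma sqrt_discr (K : fieldExtType rat) (t : int) (x : K) :
  root (fpoly_in K t) x -> (2 * (x - x^-1) - t%:~R) ^+ 2 = (t ^+ 2 - 4)%:~R.
Proof.
move=> fx; have := fx; rewrite root_fpolyE ?(root_fpoly_neq0 fx) // => /eqP.
move: (x - x^-1) => e eE; rewrite rmorphB rmorphXn /=.
apply/eqP; rewrite -subr_eq0; apply/eqP.
transitivity (4 * (e ^+ 2 - t%:~R * e + 1)); first ring.
by rewrite eE mulr0.
Qed.

Lemma Kt_contains_discr (t : int) (K : fieldExtType rat) (alpha : K) : 4 <= t ->
  is_Kt t alpha -> contains_real_quadratic K (t ^+ 2 - 4).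
Proof.
move=> t4 [f_alpha _].
apply: contains_real_quadratic_sqrt (sqrt_discr f_alpha); first by nia.
apply: (@between_squares _ (t - 1)); first lia.
have -> : (t - 1) ^+ 2 = t ^+ 2 - 2 * t + 1 by ring.
rewrite subrK; move: (t ^+ 2) => u; lia.
Qed.

Lemma exists_Kt (t : int) : 4 <= t ->
  exists (K : fieldExtType rat) (alpha : K), is_Kt t alpha.
Proof.
move=> t4; have [K _ [z fz Kz]] := irredp_FAdjoin (irreducible_fpoly_in t4).
by exists K, z; split; rewrite // -(fpoly_in_map (in_alg K)).
Qed.

(* If x^2 - d y^2 = 1, then (2x)^2 - 4 = d (2y)^2. *)
Lemma quadratic_in_some_Kt (d : nat) : (1 < d)%N -> squarefree d ->
  exists t : int, 4 <= t /\
    forall (K : fieldExtType rat) (alpha : K), is_Kt t alpha ->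
      contains_real_quadratic K d%:Z.
Proof.
move=> d1 sf; have d_ns := squarefree_not_sqr d1 sf.
have [x [y [xy y0]]] := @pell_solution realalg d d_ns.
(* The absolute value makes t positive; d >= 2 and y nonzero give x^2 >= 3, so |x| >= 2 and t >=
   4. *)
exists (2 * `|x|); split=> [|K alpha [f_alpha _]].
  have y2 : 0 < y ^+ 2 by rewrite exprn_even_gt0.
  have x2 : 3 <= x ^+ 2 by move: (x ^+ 2) (y ^+ 2) xy y2 => u v; nia.
  move: x2; rewrite -(real_normK (num_real x)) -abszE; move: (absz x) => m.
  by case: m => [|[|m]] //; lia.
have yK : 2 * y%:~R != 0 :> K.
  by rewrite -(rmorphM (intr : int -> K) 2) intr_fieldExt_eq0 mulf_neq0.
pose D := 2 * (alpha - alpha^-1) - (2 * `|x|)%:~R.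
apply: (@contains_real_quadratic_sqrt K d (D / (2 * y%:~R))) => //.
rewrite expr_div_n sqrt_discr //.
have -> : (2 * `|x|) ^+ 2 - 4 = d%:Z * (2 * y) ^+ 2 :> int.
  by rewrite exprMn real_normK ?num_real // -[x ^+ 2](subrK (d%:Z * y ^+ 2)) xy; ring.
by rewrite rmorphM rmorphXn rmorphM /= mulfK // sqrf_eq0.
Qed.

Theorem theorem3p1 :
  (forall t : int, 4 <= t ->
    [/\ (* (i) *)
        [/\ irreducible_poly (fpoly_in rat t),
            (forall z : algC, root (fpoly_in algC t) z -> z \is Num.real)
          & forall (K : fieldExtType rat) (alpha : K), is_Kt t alpha ->
              [/\ \dim {:K}%VS = 4%N, totally_real K & unit_rank K 3]],
        (* (ii) *)
        (forall (K : fieldExtType rat) (alpha : K), is_Kt t alpha ->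
          [/\ exceptional_field K, exceptional_unit alpha
            & exceptional_unit (alpha ^+ 2)]),
        (* (iii) *)
        (forall (K : fieldExtType rat) (alpha : K), is_Kt t alpha ->
          contains_real_quadratic K (t ^+ 2 - 4))
      & (* (v) *)
        forall L : splittingFieldType rat,
          splittingFieldFor 1 (fpoly_in L t) {:L}%VS ->
          (forall alpha : L, root (fpoly_in L t) alpha ->
             is_normal_closure <<1; alpha>>%VS)
          /\ ('Gal({:L} / 1) \isog 'D_8)%g])
  /\
  (* (iv) *)
  (forall d : nat, (1 < d)%N -> squarefree d ->
    exists t : int,
      [/\ 4 <= t,
          (exists (K : fieldExtType rat) (alpha : K), is_Kt t alpha)
        & forall (K : fieldExtType rat) (alpha : K), is_Kt t alpha ->
            contains_real_quadratic K d%:Z]).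
Proof.
split=> [t t4|d d1 sf]; last first.
  have [t [t4 Kd]] := quadratic_in_some_Kt d1 sf.
  by exists t; split=> //; apply: exists_Kt.
split.
- split; [exact: irreducible_fpoly_in | by move=> z; apply: root_fpoly_real |].
  move=> K alpha Kt; split; first exact: dim_Kt Kt.
    exact: totally_real_Kt Kt.
  exact: unit_rank_Kt Kt.
- move=> K alpha [f_alpha _]; have [U1 U2] := exceptional_unit_root f_alpha.
  by split=> //; exists alpha.
- by move=> K alpha; apply: Kt_contains_discr.
- move=> L splitL; split=> [alpha|]; first exact: normal_closure_L.
  have [a fa] := splitting_root splitL.
  have [b fb ab] := root_partner splitL fa.
  exact: Gal_isog_D8 fa fb ab.
Qed.
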